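(* Let $T>0$, let $\mathcal L$ be an unbounded closed operator on $L^2(\mathbb R^d)$ with dense domain $D\subseteq L^2(\mathbb R^d)$ which generates a $C_0$-semigroup on $L^2(\mathbb R^d)$. Let $F\in C([0,T];L^2(\mathbb R^d))\otimes (S)_{-1}$ be a generalized stochastic process with chaos expansion $F=\sum_{\gamma\in\mathcal I}f_\gamma H_\gamma$ whose coefficients $f_\gamma\in C([0,T];L^2(\mathbb R^d))$ are Lipschitz continuous with respect to $t$ for every $\gamma\in\mathcal I$, and let $G\in D\otimes (S)_{-1}$. Let $q\in\mathcal D'(\mathbb R^d)$, and let $(q_\varepsilon)_{\varepsilon\in(0,1]}$ and $(\tilde q_\varepsilon)_{\varepsilon\in(0,1]}$ be two different regularizing nets of $q$, both of $L^\infty(\mathbb R^d)$-log-type, such that for every $n\in\mathbb N$ there is $C>0$ with $$\|q_\varepsilon-\tilde q_\varepsilon\|_{L^\infty(\mathbb R^d)}\le C\,\varepsilon^n\quad\text{for every }\varepsilon\in(0,1].$$ Let $X=C([0,T];L^2(\mathbb R^d))$ and let $(U_\varepsilon)_{\varepsilon\in(0,1]}\subset X\otimes(S)_{-1}$ and $(\tilde U_\varepsilon)_{\varepsilon\in(0,1]}\subset X\otimes(S)_{-1}$ be two very weak solutions of the stochastic problem $$\Big(\frac{\partial}{\partial t}-\mathcal L\Big)U(t,x,\omega)+q(x)\cdot U(t,x,\omega)=F(t,x,\omega),\qquad U(0,x,\omega)=G(x,\omega),$$ $t\in(0,T]$, $x\in\mathbb R^d$, $\omega\in\Omega$, which correspond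 to $(q_\varepsilon)_{\varepsilon\in(0,1]}$ and $(\tilde q_\varepsilon)_{\varepsilon\in(0,1]}$ respectively, and let $s>1$ be such that both nets are $X\otimes(S)_{-s}$-moderate. Then for all $n\in\mathbb N$ there exists $c>0$ such that $$\|U_\varepsilon-\tilde U_\varepsilon\|_{X\otimes(S)_{-s}}\le c\,\varepsilon^n\quad\text{for all }\varepsilon\in(0,1].$$
   Context: Chaos expansions. $(\Omega,\mathcal F,\mathbb P)$ is the Gaussian white noise space. $\mathcal I$ is the set of sequences $\gamma=(\gamma_1,\gamma_2,\dots)$ of non-negative integers with only finitely many nonzero entries. For $\gamma\in\mathcal I$, $H_\gamma(\omega)=\prod_{k\ge1}h_{\gamma_k}(\langle\omega,\xi_k\rangle)$ is the Fourier–Hermite polynomial ($h_k$ Hermite polynomials, $\xi_k$ Hermite functions), and $(2\mathbb N)^{\gamma}=\prod_{i\ge1}(2i)^{\gamma_i}$. For a normed space $Y$ and $p\ge0$, $Y\otimes (S)_{-p}$ is the space of formal expansions $F=\sum_{\gamma\in\mathcal I}f_\gamma H_\gamma$ with $f_\gamma\in Y$ and $\|F\|^2_{Y\otimes (S)_{-p}}=\sum_{\gamma\in\mathcal I}\|f_\gamma\|_Y^2(2\mathbb N)^{-p\gamma}<\infty$; $Y\otimes (S)_{-1}$ denotes the union (inductive limit) of the spaces $Y\otimes (S)_{-p}$ over $p\ge0$. $X=C([0,T];L^2(\mathbb R^d))$ has norm $\sup_{t\in[0,T]}\|f(t,\cdot)\|_{L^2(\mathbb R^d)}$; $D$ and $C([0,T];D)$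 are taken with the norms of $L^2(\mathbb R^d)$ and $X$. Solutions. $\mathcal L$ acts coefficientwise in the space variable, $\mathcal LU=\sum_\gamma(\mathcal Lu_\gamma)H_\gamma$, and so does multiplication by a bounded potential. For a bounded potential $r$, $U=\sum_\gamma u_\gamma H_\gamma\in C([0,T];D)\otimes(S)_{-1}$ is a solution of $(\partial_t-\mathcal L)U+rU=F$, $U(0)=G$, if for each $\gamma\in\mathcal I$, $u_\gamma$ solves $(\partial_t-\mathcal L)u_\gamma+ru_\gamma=f_\gamma$, $u_\gamma(0,\cdot)=g_\gamma$ in the semigroup (strong) sense: $u_\gamma\in C([0,T];D)$ is absolutely continuous and differentiable a.e. as an $L^2(\mathbb R^d)$-valued function with $u_\gamma'\in L^1(0,T;L^2(\mathbb R^d))$, and satisfies the equation for a.e. $t$ and the initial condition. Regularization. A mollifier is $\varphi\in C_0^\infty(\mathbb R^d)$ with $\varphi\ge0$, $\int\varphi=1$; a mollifying net is $\varphi_\varepsilon(x)=l(\varepsilon)^{-d}\varphi(x/l(\varepsilon))$, $\varepsilon\in(0,1]$, with $l>0$ and $l(\varepsilon)\to0$ as $\varepsilon\to0$. A regularizing net of a distribution $q$ is a net of smooth functions $(q_\varepsilon)_{\varepsilon\in(0,1]}$ converging to $q$ in $\mathcal D'(\mathbb R^d)$, of the form $q_\varepsilon=q*\varphi_\varepsilon$; for a general $q\in\mathcal D'(\mathbb R^d)$, not compactly supported or bounded, the convolution may be combined with cut-off functions, i.e. $q_\varepsilon=(\chi_\varepsilon q)*\varphi_\varepsilon$ with $\chi_\varepsilon\in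 C_0^\infty(\mathbb R^d)$, $0\le\chi_\varepsilon\le1$, such that for each compact set $K$ one has $\chi_\varepsilon=1$ on $K$ for all sufficiently small $\varepsilon$. The net is of $L^\infty(\mathbb R^d)$-log-type if there exists $N>0$ with $\|q_\varepsilon\|_{L^\infty(\mathbb R^d)}\le N\log\frac1\varepsilon$ for all sufficiently small $\varepsilon$. Moderateness. A net $(b_\varepsilon)_{\varepsilon\in(0,1]}$ in a Banach space $\mathcal B$ is $\mathcal B$-moderate if there exist $N\in\mathbb N_0$, $C>0$ with $\|b_\varepsilon\|_{\mathcal B}\le C\varepsilon^{-N}$ for each $\varepsilon\in(0,1]$. In particular, a net of processes $(U_\varepsilon)$ is $X\otimes(S)_{-s}$-moderate if there exist $N\in\mathbb N_0$ and $C>0$ such that $\|U_\varepsilon\|_{X\otimes(S)_{-s}}\le C\varepsilon^{-N}$ for each $\varepsilon\in(0,1]$. Stochastic very weak solution. A net $(U_\varepsilon)_{\varepsilon\in(0,1]}$ of stochastic processes in $X\otimes(S)_{-1}$ is a very weak solution to the stochastic problem corresponding to an $L^\infty(\mathbb R^d)$-moderate regularizing net $(q_\varepsilon)_{\varepsilon\in(0,1]}$ of $q$ if for every $\varepsilon\in(0,1]$ the process $U_\varepsilon$ is a solution to the regularized equation $(\partial_t-\mathcal L)U+q_\varepsilon U=F$, $U(0)=G$, and $(U_\varepsilon)_{\varepsilon\in(0,1]}$ is a moderate net of stochastic processes, i.e. $X\otimes(S)_{-p}$-moderate for $p=\sup_\varepsilon p_\varepsilon$ where $U_\varepsilon\in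 X\otimes(S)_{-p_\varepsilon}$; it is assumed that $p>1$. *)

(* Defs.v *)
From HB Require Import structures.
From mathcomp Require Import all_boot all_order all_algebra.
From mathcomp Require Import generic_quotient ring_quotient finmap.
From mathcomp Require Import all_classical all_reals all_analysis.
From mathcomp Require Import measurable_realfun ess_sup_inf.

Set Implicit Arguments.
Unset Strict Implicit.
Unset Printing Implicit Defensive.

Import Order.TTheory GRing.Theory Num.Theory.
Import numFieldNormedType.Exports.

Local Open Scope classical_set_scope.
Local Open Scope ring_scope.

(* Measurable structure on 'rV[R]_n: the product sigma-algebra, generated by
   the coordinate maps, as the library does for n.-tuple R. It is the Borel
   sigma-algebra of R^n. *)
Definition measure_row_display : measure_display -> measure_display.
Proof. exact. Qed.

Section measurable_row.
Context {R : realType}.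
Variable n : nat.

Let coord : 'I_n -> 'rV[R]_n -> R := fun i x => x ord0 i.

Let row_set0 : g_sigma_preimage coord set0.
Proof. exact: sigma_algebra0. Qed.

Let row_setC A : g_sigma_preimage coord A -> g_sigma_preimage coord (~` A).
Proof. exact: sigma_algebraC. Qed.

Let row_bigcup (F : _^nat) : (forall i, g_sigma_preimage coord (F i)) ->
  g_sigma_preimage coord (\bigcup_i (F i)).
Proof. exact: sigma_algebra_bigcup. Qed.

HB.instance Definition _ := @isMeasurable.Build
  (measure_row_display default_measure_display)
  'rV[R]_n (g_sigma_preimage coord) row_set0 row_setC row_bigcup.

End measurable_row.

Lemma measurable_row_coord (R : realType) n (i : 'I_n) :
  measurable_fun [set: 'rV[R]_n] (fun x => x ord0 i).
Proof.
move=> _ Y mY; rewrite setTI; apply: sub_sigma_algebra.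
rewrite -bigcup_seq/=; exists i => //=; first by rewrite mem_index_enum.
by exists Y => //; rewrite setTI.
Qed.

Lemma measurable_row d (T : measurableType d) (R : realType) n
    (f : T -> 'rV[R]_n) :
  (forall i, measurable_fun [set: T] (fun x => f x ord0 i)) ->
  measurable_fun [set: T] f.
Proof.
move=> mf.
pose G := \big[setU/set0]_(i < n)
  preimage_set_system [set: 'rV[R]_n] (fun x => x ord0 i) measurable.
have mG : @measurable _ 'rV[R]_n = <<s G >> by [].
apply: (measurability G mG) => _ [B + <-].
rewrite /G -bigcup_seq/= => -[i _ [A mA <-]].
by rewrite [X in _ `&` _ @^-1` X]setTI; exact: mf.
Qed.

Section lebesgue_row.
Context {R : realType}.

Definition row_cons n (p : R * 'rV[R]_n) : 'rV[R]_n.+1 :=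
  row_mx p.1%:M p.2 : 'rV[R]_(1 + n).

Definition row_uncons n (x : 'rV[R]_n.+1) : R * 'rV[R]_n :=
  (x ord0 ord0, rsubmx (x : 'rV[R]_(1 + n))).

Lemma row_consK n : cancel (@row_cons n) (@row_uncons n).
Proof.
case=> a v; rewrite /row_uncons /row_cons row_mxKr/=.
have e : (ord0 : 'I_n.+1) = lshift n (ord0 : 'I_1) by exact: val_inj.
congr pair; rewrite [X in fun_of_matrix _ _ X]e.
by etransitivity; [exact: row_mxEl|rewrite mxE].
Qed.

Lemma measurable_row_cons n : measurable_fun setT (@row_cons n).
Proof.
apply: measurable_row => i; rewrite -(@splitK 1 n i).
case: (@fintype.split 1 n i) => j; rewrite [unsplit _]/=.
- apply: (eq_measurable_fun fst) => // p _.
  rewrite /row_cons/=; symmetry; etransitivity; first exact: row_mxEl.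
  by rewrite mxE (ord1 j).
- apply: (eq_measurable_fun (fun p : R * 'rV[R]_n => p.2 ord0 j)).
    by move=> p _; rewrite /row_cons/=; symmetry; exact: row_mxEr.
  exact: (measurableT_comp (measurable_row_coord j) measurable_snd).
Qed.

Lemma measurable_row_uncons n : measurable_fun setT (@row_uncons n).
Proof.
apply/measurable_fun_pairP; split; first exact: measurable_row_coord.
apply: measurable_row => i.
apply: (eq_measurable_fun (fun x : 'rV[R]_n.+1 => x ord0 (rshift 1 i))).
  by move=> x _; rewrite /= mxE.
exact: measurable_row_coord.
Qed.

Section cons_measure.
Variables (m : {sigma_finite_measure set (measurableTypeR R) -> \bar R}).
Variables (n : nat) (mu : {sigma_finite_measure set 'rV[R]_n -> \bar R}).

Definition row_cons_measure : set 'rV[R]_n.+1 -> \bar R :=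
  pushforward (m \x mu)%E (@row_cons n).

Let row_cons_measure0 : row_cons_measure set0 = 0%E.
Proof. by rewrite /row_cons_measure /pushforward preimage_set0 measure0. Qed.

Let row_cons_measure_ge0 A : (0 <= row_cons_measure A)%E.
Proof. by rewrite /row_cons_measure /pushforward measure_ge0. Qed.

Let row_cons_measure_sigma_additive : semi_sigma_additive row_cons_measure.
Proof.
move=> F mF tF mUF; rewrite /row_cons_measure /pushforward preimage_bigcup.
have mcons A : measurable A -> measurable (@row_cons n @^-1` A).
  by move=> mA; rewrite -[X in measurable X]setTI; exact: measurable_row_cons.
apply: measure_semi_sigma_additive.
- by move=> k; exact: mcons.
- by apply/trivIsetP => i j _ _ ij; rewrite -preimage_setI;
    move/trivIsetP : tF => ->//; rewrite preimage_set0.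
- by rewrite -preimage_bigcup; exact: mcons.
Qed.

HB.instance Definition _ := isMeasure.Build _ _ _ row_cons_measure
  row_cons_measure0 row_cons_measure_ge0 row_cons_measure_sigma_additive.

Let row_cons_sigma_finite : sigma_finite setT row_cons_measure.
Proof.
have /sigma_finiteP[F [TF ndF Foo]] := sigma_finiteT m.
have /sigma_finiteP[G [TG ndG Goo]] := sigma_finiteT mu.
exists (fun i => @row_uncons n @^-1` (F i `*` G i)).
  apply/seteqP; split=> [x _|//].
  have [k _ Fk] : (\bigcup_k F k) (row_uncons x).1 by rewrite -TF.
  have [l _ Gl] : (\bigcup_k G k) (row_uncons x).2 by rewrite -TG.
  exists (maxn k l) => //; split.
  - by move: Fk; exact/subsetPset/ndF/leq_maxl.
  - by move: Gl; exact/subsetPset/ndG/leq_maxr.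
move=> k; have [mF ?] := Foo k; have [mG ?] := Goo k; split.
  rewrite -[X in measurable X]setTI; apply: measurable_row_uncons => //.
  exact: measurableX.
rewrite /row_cons_measure /pushforward.
rewrite (_ : _ @^-1` _ = F k `*` G k).
  by rewrite product_measure1E// lte_mul_pinfty// ge0_fin_numE.
by rewrite -comp_preimage (_ : _ \o _ = id)//; apply/funext; exact: row_consK.
Qed.

HB.instance Definition _ :=
  Measure_isSigmaFinite.Build _ _ _ row_cons_measure row_cons_sigma_finite.

End cons_measure.

(* Lebesgue measure on R^n: the n-fold product of lebesgue_measure, transported
   along the bijections R * R^n -> R^(n + 1). *)
Fixpoint lebesgue_row n : {sigma_finite_measure set 'rV[R]_n -> \bar R} :=
  match n with
  | 0 => \d_(0 : 'rV[R]_0)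
  | n'.+1 => row_cons_measure lebesgue_measure (lebesgue_row n')
  end.

End lebesgue_row.

Lemma ae_eq_Lnorm d (T : measurableType d) (R : realType)
    (mu : {measure set T -> \bar R}) (p : \bar R) (f g : T -> R) :
  (1 <= p)%E -> measurable_fun setT f -> measurable_fun setT g ->
  f = g %[ae mu] -> ('N[mu]_p[EFin \o f] = 'N[mu]_p[EFin \o g])%E.
Proof.
move=> p1 mf mg fg; rewrite unlock; case: p p1 => [r|_|] //=; last first.
  case: ifPn => // _; apply: eq_ess_sup.
  by move: fg; apply: filterS => x /(_ I) /= ->.
have mr (h : T -> R) : measurable_fun setT h ->
    measurable_fun setT ((fun x : T => `|(h x)%:E| `^ r)%E : T -> \bar R).
  move=> mh; apply: (measurableT_comp (measurable_poweR r)).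
  by apply: measurableT_comp => //; exact/measurable_EFinP.
move=> _; congr (_ `^ _)%E; apply: ge0_ae_eq_integral => //; try exact: mr.
by move: fg; apply: filterS => x /(_ I) /= -> _.
Qed.

(* The space L^p(mu): LfunType mu p1 modulo equality mu-almost
   everywhere, with the L^p norm. LspaceType of the library has no linear or
   normed structure. *)
Section Lp_space.
Context d (T : measurableType d) (R : realType).
Variables (mu : {measure set T -> \bar R}) (p : \bar R) (p1 : (1 <= p)%E).

Definition Lp_null : {pred LfunType mu p1} :=
  fun f => `[< f = cst 0 %[ae mu] >].

Let Lp_null_zmod_closed : zmod_closed Lp_null.
Proof.
split=> [|f g /asboolP f0 /asboolP g0]; apply/asboolP; first exact: aeW.
by move: f0 g0; apply: filterS2 => x /= fx gx _;
  rewrite -[LHS]/(f x - g x) fx// gx// subrr.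
Qed.

HB.instance Definition _ := GRing.isZmodClosed.Build _ Lp_null Lp_null_zmod_closed.

Definition Lp : Type := Quotient.quot Lp_null.
HB.instance Definition _ := GRing.Zmodule.on Lp.

Local Open Scope quotient_scope.

Definition Lp_class (f : LfunType mu p1) : Lp := \pi_(Quotient.quot Lp_null) f.

Definition Lp_repr (u : Lp) : LfunType mu p1 := repr (u : Quotient.quot Lp_null).

Lemma Lp_reprK : cancel Lp_repr Lp_class.
Proof. by move=> u; rewrite /Lp_class /Lp_repr reprK. Qed.

Lemma Lp_classP (f g : LfunType mu p1) :
  Lp_class f = Lp_class g <-> f = g %[ae mu].
Proof.
split=> [/eqP|fg].
  rewrite eqmodE /= Quotient.equivE => /asboolP.
  by apply: filterS => x /(_ I) /= /eqP; rewrite subr_eq0 => /eqP.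
apply/eqP; rewrite eqmodE /= Quotient.equivE; apply/asboolP.
by move: fg; apply: filterS => x /(_ I) fg _; rewrite -[LHS]/(f x - g x) fg subrr.
Qed.

Lemma Lp_classK (f : LfunType mu p1) : Lp_repr (Lp_class f) = f %[ae mu].
Proof. by apply/Lp_classP; rewrite Lp_reprK. Qed.

Lemma Lp_classD (f g : LfunType mu p1) :
  Lp_class (f + g) = Lp_class f + Lp_class g.
Proof. by rewrite /Lp_class raddfD. Qed.

Let Lp_scale (a : R) (u : Lp) : Lp := Lp_class (a *: Lp_repr u).

Let Lp_scale_class a f : Lp_scale a (Lp_class f) = Lp_class (a *: f).
Proof.
apply/Lp_classP; have := Lp_classK f.
apply: filterS => x /(_ I) fx _.
by rewrite -[LHS]/(a *: (Lp_repr (Lp_class f) x)) fx.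
Qed.

Let Lp_scalerA a b u : Lp_scale a (Lp_scale b u) = Lp_scale (a * b) u.
Proof. by rewrite -[u]Lp_reprK !Lp_scale_class scalerA. Qed.

Let Lp_scale1r : left_id 1 Lp_scale.
Proof. by move=> u; rewrite -[u]Lp_reprK Lp_scale_class scale1r. Qed.

Let Lp_scalerDr : right_distributive Lp_scale +%R.
Proof.
move=> a u v; rewrite -[u]Lp_reprK -[v]Lp_reprK -Lp_classD !Lp_scale_class.
by rewrite scalerDr Lp_classD.
Qed.

Let Lp_scalerDl u : {morph Lp_scale^~ u : a b / a + b}.
Proof.
by move=> a b; rewrite -[u]Lp_reprK !Lp_scale_class scalerDl Lp_classD.
Qed.

HB.instance Definition _ := GRing.Zmodule_isLmodule.Build R Lp
  Lp_scalerA Lp_scale1r Lp_scalerDr Lp_scalerDl.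

Lemma Lp_classZ a (f : LfunType mu p1) : Lp_class (a *: f) = a *: Lp_class f.
Proof. by rewrite -[RHS]/(Lp_scale _ _) Lp_scale_class. Qed.

Let Lp_norm (u : Lp) : R := fine ('N[mu]_p[EFin \o Lp_repr u])%E.

Let Lp_norm_class f : Lp_norm (Lp_class f) = fine ('N[mu]_p[EFin \o f])%E.
Proof. by congr fine; apply: ae_eq_Lnorm => //; exact: Lp_classK. Qed.

Let Lp_ler_normD u v : Lp_norm (u + v) <= Lp_norm u + Lp_norm v.
Proof.
rewrite -[u]Lp_reprK -[v]Lp_reprK -Lp_classD !Lp_norm_class.
exact: ler_LnormD.
Qed.

Let Lp_normrZ a u : Lp_norm (a *: u) = `|a| * Lp_norm u.
Proof.
rewrite -[u]Lp_reprK -Lp_classZ !Lp_norm_class.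
by apply: EFin_inj; rewrite EFinM !finite_norm_fine -LnormZ.
Qed.

Let Lp_normr0_eq0 u : Lp_norm u = 0 -> u = 0.
Proof.
rewrite -[u]Lp_reprK Lp_norm_class => /fine_Lnormr_eq0 u0.
have -> : 0 = Lp_class 0 :> Lp by rewrite /Lp_class raddf0.
exact/Lp_classP.
Qed.

HB.instance Definition _ := Lmodule_isNormed.Build R Lp
  Lp_ler_normD Lp_normrZ Lp_normr0_eq0.

Lemma Lp_normE (f : LfunType mu p1) :
  `|Lp_class f| = fine ('N[mu]_p[EFin \o f])%E.
Proof. exact: Lp_norm_class. Qed.

(* Pointwise product of a function with an element of L^p. The default value
   0 is used only when r * u is not in L^p, so never for r measurable and
   essentially bounded. *)
Definition Lp_mul (r : T -> R) (u : Lp) : Lp :=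
  Lp_class (insubd (0 : LfunType mu p1) (fun x => r x * Lp_repr u x)).

End Lp_space.

Definition L2 (R : realType) (d : nat) : normedModType R :=
  Lp (@lebesgue_row R d) (lee1n 2).

Section semigroup.
Context {R : realType} {V : normedModType R}.
Implicit Types (S : R -> V -> V) (D : set V) (L : V -> V).

(* An unbounded (that is, not necessarily bounded) operator is a subspace D
   with a map that is linear on D; the values of L outside D are irrelevant. *)
Definition linear_operator D L :=
  D 0 /\ forall (a : R) x y, D x -> D y ->
    D (a *: x + y) /\ L (a *: x + y) = a *: L x + L y.

Definition closed_operator D L :=
  closed [set z : V * V | D z.1 /\ z.2 = L z.1].

Definition C0_semigroup S :=
  [/\ forall t, 0 <= t -> linear (S t) /\ continuous (S t),
      S 0 =1 id,
      forall s t, 0 <= s -> 0 <= t -> S (s + t) =1 S s \o S t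
    & forall x, S t x @[t --> 0^'+] --> x].

Definition generator S D L :=
  D = [set x | cvg (h^-1 *: (S h x - x) @[h --> 0^'+])] /\
  forall x, D x -> h^-1 *: (S h x - x) @[h --> 0^'+] --> L x.

Definition generates_C0_semigroup D L :=
  exists S, C0_semigroup S /\ generator S D L.

End semigroup.

Section vector_valued.
Context {R : realType} {V : normedModType R}.
Implicit Types (T : R) (u v : R -> V) (A : set R).

(* Functions on [0, T] are represented by functions on R, whose values outside
   [0, T] are irrelevant. *)
Definition path_continuous T : set (R -> V) :=
  [set u | {within `[0, T], continuous u}].

Definition path_norm T u : \bar R :=
  ereal_sup [set `|u t|%:E | t in `[0, T]].

Definition absolutely_continuous_path T u :=
  forall e, 0 < e -> exists2 delta, 0 < delta &
    forall n (a b : 'I_n -> R),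
      (forall i, [/\ 0 <= a i, a i <= b i & b i <= T]) ->
      trivIset setT (fun i => `]a i, b i[%classic) ->
      \sum_i (b i - a i) < delta -> \sum_i `|u (b i) - u (a i)| < e.

Definition strongly_measurable A v :=
  exists s : nat -> R -> V,
    (forall k, finite_set (range (s k)) /\
       forall y, measurable (s k @^-1` [set y])) /\
    {ae lebesgue_measure, forall t, A t -> s k t @[k --> \oo] --> v t}.

Definition bochner_integrable A v :=
  strongly_measurable A v /\
  (\int[lebesgue_measure]_(t in A) `|v t|%:E < +oo)%E.

(* u' - L u + M u = f on (0, T), u(0) = g; M stands for the multiplication by
   the potential. *)
Definition strong_solution T (D : set V) (L M : V -> V) (f : R -> V) (g : V) u :=
  [/\ path_continuous T u /\ (forall t, t \in `[0, T] -> D (u t)),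
      absolutely_continuous_path T u /\
        {ae lebesgue_measure, forall t, `]0, T[%classic t -> derivable u t 1},
      bochner_integrable `]0, T[ (u^`())%classic,
      {ae lebesgue_measure, forall t, `]0, T[%classic t ->
         (u^`())%classic t - L (u t) + M (u t) = f t}
    & u 0 = g].

End vector_valued.

Definition chaos_index := {fsfun nat -> nat for (fun=> 0%N)}.

Section chaos.
Context {R : realType} {Y : Type}.
Implicit Types (P : set Y) (nm : Y -> \bar R) (p : R) (F : chaos_index -> Y).

(* (2N)^gamma; the i-th entry, i >= 1, of the sequence gamma is gamma i.-1. *)
Definition chaos_weight (gamma : chaos_index) : R :=
  \prod_(i <- finsupp gamma) (2 * i.+1)%:R ^+ gamma i.

(* A formal expansion \sum_gamma f_gamma H_gamma is represented by the family
   of its coefficients. The coefficient space is the set P of a type Y, normed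
   by nm; nm and the chaos norms may take the value +oo. *)
Definition chaos_norm nm p F : \bar R :=
  ((\esum_(gamma in [set: chaos_index])
      (nm (F gamma) ^+ 2 * (chaos_weight gamma `^ (- p))%:E)) `^ 2^-1)%E.

Definition chaos_space P nm p : set (chaos_index -> Y) :=
  [set F | (forall gamma, P (F gamma)) /\ (chaos_norm nm p F < +oo)%E].

Definition chaos_space1 P nm : set (chaos_index -> Y) :=
  [set F | exists2 p, 0 <= p & chaos_space P nm p F].

End chaos.

Definition moderate (R : realType) (b : R -> \bar R) :=
  exists (N : nat) (C : R), 0 < C /\
    forall e, e \in `]0, 1] -> (b e <= (C * e ^- N)%:E)%E.

Section distributions.
Context {R : realType} {d : nat}.
Local Notation Rd := 'rV[R]_d.
Implicit Types (f phi psi chi : Rd -> R) (l : R -> R).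

Definition partial_deriv (i : 'I_d) f : Rd -> R := 'D_(delta_mx ord0 i) f.

Definition iter_partial (s : seq 'I_d) f : Rd -> R := foldr partial_deriv f s.

Definition smooth f := forall s : seq 'I_d,
  continuous (iter_partial s f) /\
  forall i x, derivable (iter_partial s f) x (delta_mx ord0 i).

Definition closed_support f : set Rd := closure [set x | f x != 0].

Definition test_function phi := smooth phi /\ compact (closed_support phi).

(* The values of a distribution outside the test functions are irrelevant. In
   the continuity estimate, M runs over the upper bounds of the derivatives of
   phi of order at most m. *)
Structure schwartz_distribution := SchwartzDistribution {
  dist_app :> (Rd -> R) -> R;
  dist_linear : forall a phi psi, test_function phi -> test_function psi ->
    dist_app (fun x => a * phi x + psi x) = a * dist_app phi + dist_app psi;
  dist_continuous : forall K : set Rd, compact K -> exists (C : R) (m : nat),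
    forall phi, test_function phi -> closed_support phi `<=` K ->
    forall M : R,
      (forall s x, (size s <= m)%N -> `|iter_partial s phi x| <= M) ->
      `|dist_app phi| <= C * M
}.

Definition dist_mul chi (q : (Rd -> R) -> R) : (Rd -> R) -> R :=
  fun psi => q (fun y => chi y * psi y).

Definition dist_conv (q : (Rd -> R) -> R) phi : Rd -> R :=
  fun x => q (fun y => phi (x - y)).

Definition mollifier phi :=
  [/\ test_function phi, forall x, 0 <= phi x
    & \int[lebesgue_row d]_x phi x = 1].

Definition mollifying_net phi l : R -> Rd -> R :=
  fun e x => l e ^- d * phi ((l e)^-1 *: x).

Definition cutoff_net (chi : R -> Rd -> R) :=
  (forall e, e \in `]0, 1] ->
     test_function (chi e) /\ forall x, 0 <= chi e x <= 1) /\
  forall K : set Rd, compact K ->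
    \forall e \near 0^'+, forall x, K x -> chi e x = 1.

Definition dist_converges (qe : R -> Rd -> R) (q : schwartz_distribution) :=
  forall psi, test_function psi ->
    \int[lebesgue_row d]_x (qe e x * psi x) @[e --> 0^'+] --> q psi.

Definition regularizing_net (q : schwartz_distribution) (qe : R -> Rd -> R) :=
  [/\ forall e, e \in `]0, 1] -> smooth (qe e),
      dist_converges qe q
    & exists phi l,
      [/\ mollifier phi,
          forall e, e \in `]0, 1] -> 0 < l e,
          l e @[e --> 0^'+] --> (0 : R)
        & (forall e, e \in `]0, 1] ->
             qe e = dist_conv q (mollifying_net phi l e)) \/
          exists2 chi, cutoff_net chi & forall e, e \in `]0, 1] ->
             qe e = dist_conv (dist_mul (chi e) q) (mollifying_net phi l e)]].

Definition Linf_norm f : \bar R := ('N[lebesgue_row d]_+oo[EFin \o f])%E.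

Definition log_type (qe : R -> Rd -> R) :=
  exists2 N : R, 0 < N &
    \forall e \near 0^'+, (Linf_norm (qe e) <= (N * ln e^-1)%:E)%E.

End distributions.

Arguments schwartz_distribution : clear implicits.

Section very_weak_solutions.
Context {R : realType} {d : nat}.
Local Notation V := (L2 R d).
Variable T : R.

Definition chaosX_norm (p : R) (U : chaos_index -> R -> V) : \bar R :=
  chaos_norm (path_norm T) p U.

Definition chaosX_space (p : R) : set (chaos_index -> R -> V) :=
  chaos_space (path_continuous T) (path_norm T) p.

Definition chaosX_space1 : set (chaos_index -> R -> V) :=
  chaos_space1 (path_continuous T) (path_norm T).

Definition chaosD_space1 (D : set V) : set (chaos_index -> V) :=
  chaos_space1 D (fun x => `|x|%:E).

Definition chaosXD_space1 (D : set V) : set (chaos_index -> R -> V) :=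
  chaos_space1
    [set u | path_continuous T u /\ forall t, t \in `[0, T] -> D (u t)]
    (path_norm T).

Definition chaos_solution (D : set V) (L : V -> V) (r : 'rV[R]_d -> R)
    (F : chaos_index -> R -> V) (G : chaos_index -> V)
    (U : chaos_index -> R -> V) :=
  chaosXD_space1 D U /\
  forall gamma,
    strong_solution T D L (Lp_mul r) (F gamma) (G gamma) (U gamma).

Definition very_weak_solution (D : set V) (L : V -> V)
    (q : schwartz_distribution R d) (qe : R -> 'rV[R]_d -> R)
    (F : chaos_index -> R -> V) (G : chaos_index -> V)
    (U : R -> chaos_index -> R -> V) :=
  [/\ regularizing_net q qe,
      moderate (fun e => Linf_norm (qe e)),
      forall e, e \in `]0, 1] -> chaos_solution D L (qe e) F G (U e)
    & exists pe : R -> R,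
      let p := sup [set pe e | e in `]0, 1]] in
      [/\ forall e, e \in `]0, 1] -> 0 <= pe e /\ chaosX_space (pe e) (U e),
          has_ubound [set pe e | e in `]0, 1]],
          1 < p
        & moderate (fun e => chaosX_norm p (U e))]].

End very_weak_solutions.

(* Main.v *)
From HB Require Import structures.
Require Import Defs.
From mathcomp Require Import all_boot all_order all_algebra finmap.
From mathcomp Require Import all_classical all_reals all_analysis.
From mathcomp Require Import measurable_realfun ess_sup_inf ring lra.

Set Implicit Arguments.
Unset Strict Implicit.
Unset Printing Implicit Defensive.

Import Order.TTheory GRing.Theory Num.Theory.
Import numFieldNormedType.Exports.

Local Open Scope classical_set_scope.
Local Open Scope ring_scope.

(** Fix [e] and a chaos index, and let [W] be the difference of the two
    coefficients, [u'] the coefficient of the second solution. Almost everywhere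
    [W' = L W - q_e W - (q_e - q'_e) u'], and [W 0 = 0]. If the semigroup [S] of
    [L] satisfies [|S t x| <= M e^(w t) |x|], this forces
      [sup |W| <= e^((w + M |q_e|) T) M T |q_e - q'_e| sup |u'|],
    where the sups are over [0, T] and the potentials are measured in L^oo
    ([strong_solution_stability]). The factor of [sup |u'|] does not depend on
    the chaos index, so the same inequality holds between the norms of the
    expansions ([chaos_norm_le]). By the log-type bound the exponential is at
    most a power of [1 / e] ([log_growth_exp]), the norm of the second solution
    is at most a power of [1 / e] by moderateness, and [|q_e - q'_e|] is smaller
    than every power of [e]; hence the product is too.

    The textbook route to the bound on [W] is Duhamel's formula and Gronwall's
    lemma. The proof below replaces the vector-valued integral by a differential
    inequality. The norm [nu x = sup_t e^(- w t) |S t x|] is equivalent to the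
    original one and satisfies [nu (S h x) <= e^(w h) nu x]
    ([semigroup_adapted_norm]). Where [W] is differentiable with [W t] in the
    domain of [L],
      [W (t + h) = S h (W t) + h (W' t - L (W t)) + o(h)],
    because both [W (t + h)] and [S h (W t)] have a first-order expansion at
    [h = 0]. Thus, for almost every [t], [phi = nu o W] has an upper right derivative
    at most [(w + M |q_e|) phi + M |q_e - q'_e| sup |u'|]. Since [phi] is absolutely
    continuous, the exceptional null set is harmless: it is covered by an open
    set so small that [phi] has total variation at most [eta] on it
    ([gronwall_ae]).

    That a strongly continuous semigroup is exponentially bounded rests on the
    uniform boundedness principle, hence on the completeness of L^2, which is
    proved first, for all finite exponents ([Lp_complete]). *)

(** * Completeness of L^p *)

(** A Cauchy filter gives balls of radius [2^-n / 4] that belong to it.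
    Two members of a proper filter meet, so consecutive centres are at most
    [2^-n] apart, without nesting the balls. *)
Lemma complete_of_fast_cauchy (R : realType) (V : normedModType R) :
  (forall x : nat -> V, (forall n, `|x n.+1 - x n| <= 2^-1 ^+ n) ->
     exists y : V, x @ \oo --> y) ->
  forall F : set_system V, ProperFilter F -> cauchy F -> cvg F.
Proof.
move=> fastV F FF /(proj1 (@cauchyP _ _ F FF)) Fc.
have r0 n : 0 < 4^-1 * 2^-1 ^+ n :> R by rewrite mulr_gt0 ?exprn_gt0 ?invr_gt0.
have /choice[c Fc'] n := Fc _ (r0 n).
have [n|y cy] := fastV c.
  have [z [/= ]] := filter_ex (@filterI _ _ _ _ _ (Fc' n) (Fc' n.+1)).
  rewrite -!ball_normE /= => zn zm.
  rewrite -[c n.+1 - _](subrKA z) (le_trans (ler_normD _ _))//.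
  rewrite [X in _ + X]distrC.
  have : 0 < 2^-1 ^+ n :> R by rewrite exprn_gt0 ?invr_gt0.
  move: zn zm; rewrite exprS; lra.
apply/cvg_ex; exists y; apply/cvg_ballP => e e0.
have e2 : 0 < e / 2 by rewrite divr_gt0.
have /cvgrPdist_lt/(_ _ e2) cyn := cy.
have : (4^-1 * 2^-1 ^+ n : R) @[n --> \oo] --> (0 : R).
  rewrite -[0 in X in _ --> X](mulr0 4^-1); apply: cvgM; first exact: cvg_cst.
  by apply: cvg_expr; rewrite ger0_norm; lra.
move=> /cvgrPdist_lt/(_ _ e2) sn.
have [n _ /(_ n (leqnn n))[/= cyn' sn']] := @filterI _ _ _ _ _ cyn sn.
apply: filterS (Fc' n) => z; rewrite -!ball_normE /= => zn.
rewrite -(subrKA (c n)) (le_lt_trans (ler_normD _ _))//.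
move: sn'; rewrite sub0r normrN ger0_norm ?(ltW (r0 n))//; lra.
Qed.

Lemma cvg_norm_powR (R : realType) (p a : R) (u : nat -> R) : 0 < p ->
  u @ \oo --> a -> `|u n| `^ p @[n --> \oo] --> `|a| `^ p.
Proof.
move=> p0 /cvg_norm ua; have [a0|a0] := eqVneq a 0.
  rewrite a0 normr0 powR0 ?gt_eqF//; apply/cvgrPdist_lt => e e0.
  have d0 : 0 < e `^ p^-1 by rewrite powR_gt0.
  move/cvgrPdist_lt : ua => /(_ _ d0); apply: filterS => n.
  rewrite a0 normr0 !sub0r !normrN normr_id => un.
  rewrite ger0_norm ?powR_ge0// -[ltRHS](@powRr1 _ e) ?ltW//.
  rewrite -(@mulVf _ p) ?gt_eqF// powRrM.
  by rewrite gt0_ltr_powR ?nnegrE ?powR_ge0.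
have a0' : 0 < `|a| by rewrite normr_gt0.
have c : {for `|a|, continuous (@powR R ^~ p)}.
  apply: differentiable_continuous; apply/derivable1_diffP.
  by apply: derivable_powR; rewrite in_itv/= a0'.
exact: continuous_cvg c ua.
Qed.

Section Lp_complete.
Context d (T : measurableType d) (R : realType).
Variables (mu : {measure set T -> \bar R}).

Lemma Lp_classB p (p1 : (1 <= p)%E) (f g : LfunType mu p1) :
  Lp_class (f - g) = Lp_class f - Lp_class g.
Proof. by rewrite Lp_classD -[- g]scaleN1r Lp_classZ scaleN1r. Qed.

Lemma Lp_dist_Lnorm p (p1 : (1 <= p)%E) (u v : Lp mu p1) :
  ('N[mu]_p[EFin \o (fun x => Lp_repr u x - Lp_repr v x)%R] = `|u - v|%:E)%E.
Proof.
by rewrite -[in RHS](Lp_reprK u) -[in RHS](Lp_reprK v) -Lp_classB Lp_normE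
  finite_norm_fine.
Qed.

Variable p : R.
Hypothesis p1 : (1 <= p%:E)%E.
Local Notation Lpp := (Lp mu p1).

Let pge1 : 1 <= p. Proof. by rewrite -lee_fin. Qed.
Let pgt0 : 0 < p. Proof. exact: lt_le_trans pge1. Qed.

Lemma Lnorm_pow (f : T -> R) :
  (\int[mu]_x (`|f x| `^ p)%:E = 'N[mu]_p%:E[EFin \o f] `^ p)%E.
Proof. by rewrite poweR_Lnorm ?gt_eqF. Qed.

Lemma Lnorm_sum_norm (f : nat -> LfunType mu p1) n :
  ('N[mu]_p%:E[EFin \o (fun x => \sum_(k < n) `|f k x|)%R] <=
   \sum_(k < n) 'N[mu]_p%:E[EFin \o f k])%E.
Proof.
elim: n => [|n IH].
  rewrite big_ord0 (_ : _ \o _ = cst 0%E) ?Lnorm0//; first by rewrite eqe gt_eqF.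
  by apply/funext => x /=; rewrite big_ord0.
have me k : measurable_fun setT (fun x => `|f k x|).
  by apply: measurableT_comp => //.
rewrite big_ord_recr /= (_ : (fun x => _) =
  ((fun x => \sum_(k < n) `|f k x|) \+ (fun x => `|f n x|))%R); last first.
  by apply/funext => x /=; rewrite big_ord_recr.
apply: (le_trans (eminkowski _ _ _ p1)) => //.
  by apply: measurable_sum.
apply: leeD => //.
by rewrite -[leRHS]Lnorm_abse.
Qed.

(** Riesz-Fischer, pointwise part: the sum of the absolute increments has an L^p
    norm of at most [2], by Minkowski and monotone convergence, so it is finite
    almost everywhere, and there the increments form an absolutely convergent
    series. *)
Lemma ae_cvg_fast_cauchy (x : nat -> Lpp) :
  (forall n, `|x n.+1 - x n| <= 2^-1 ^+ n) ->
  {ae mu, forall t, cvgn (fun n => Lp_repr (x n) t)}.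
Proof.
move=> xfast.
pose f n : LfunType mu p1 := Lp_repr (x n.+1) - Lp_repr (x n).
pose g n t : R := \sum_(k < n) `|f k t|.
have g0 n t : 0 <= g n t by apply: sumr_ge0.
have mg n : measurable_fun setT (g n).
  by apply: measurable_sum => k; apply: measurableT_comp.
have gnd t : nondecreasing_seq (g ^~ t).
  by apply/nondecreasing_seqP => n; rewrite /g big_ord_recr /= lerDl.
pose G n t := (g n t `^ p)%:E.
have mG n : measurable_fun setT (G n).
  by apply/measurable_EFinP; apply: (measurableT_comp (measurable_powR _) (mg n)).
have G0 n t : setT t -> (0 <= G n t)%E by move=> _; rewrite lee_fin powR_ge0.
have Gnd t : setT t -> nondecreasing_seq (G ^~ t).
  move=> _ m n mn; rewrite lee_fin ge0_ler_powR ?nnegrE ?(ltW pgt0)//.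
  exact: gnd.
have IG n : (\int[mu]_t G n t <= (2 `^ p)%:E)%E.
  have -> : (\int[mu]_t G n t = 'N[mu]_p%:E[EFin \o g n] `^ p)%E.
    rewrite -Lnorm_pow; apply: eq_integral => t _.
    by rewrite /G ger0_norm.
  rewrite -poweR_EFin; apply: gt0_ler_poweR.
  - exact: ltW.
  - by rewrite in_itv /= leey Lnorm_ge0.
  - by rewrite in_itv /= leey lee_fin ler0n.
  apply: le_trans (Lnorm_sum_norm f n) _.
  have -> : (\sum_(k < n) 'N[mu]_p%:E[EFin \o f k] =
             \sum_(k < n) `|x k.+1 - x k|%:E)%E.
    by apply: eq_bigr => k _; rewrite -Lp_dist_Lnorm.
  rewrite sumEFin lee_fin; apply: (@le_trans _ _ (\sum_(k < n) 2^-1 ^+ k)).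
    exact: ler_sum.
  have E : \sum_(k < n) 2^-1 ^+ k = 2 - 2 * 2^-1 ^+ n :> R.
    elim: n => [|n IH]; first by rewrite big_ord0 expr0 mulr1 subrr.
    by rewrite big_ord_recr /= IH exprS; lra.
  by rewrite E gerBl mulr_ge0// exprn_ge0.
have Gcvg t : cvgn (G ^~ t) by exact/ereal_nondecreasing_is_cvgn/Gnd.
have iG : mu.-integrable setT (fun t => limn (G ^~ t)).
  apply/integrableP; split; first by apply: emeasurable_fun_cvg mG _ => t _.
  have -> : (\int[mu]_t `|limn (G ^~ t)| = \int[mu]_t limn (G ^~ t))%E.
    apply: eq_integral => t _; rewrite gee0_abs//.
    by apply: lime_ge => //; apply: nearW => n; exact: G0.
  rewrite monotone_convergence//.
  apply: (@le_lt_trans _ _ (2 `^ p)%:E); last by rewrite ltry.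
  apply: lime_le; last exact: nearW.
  apply: ereal_nondecreasing_is_cvgn => m n mn.
  by apply: ge0_le_integral => // t _; first [exact: G0|exact: (Gnd t I m n mn)].
have := integrable_ae measurableT iG.
apply: filterS => t /(_ I) Gfin.
have Gle n : (G n t <= limn (G ^~ t))%E.
  rewrite (cvg_lim _ (ereal_nondecreasing_cvgn (Gnd t I)))//.
  by apply: ereal_sup_ubound; exists n.
have gbd n : g n t <= fine (limn (G ^~ t)) `^ p^-1.
  rewrite -[leLHS](@powRr1 _ (g n t))// -(@mulfV _ p) ?gt_eqF// powRrM.
  rewrite ge0_ler_powR ?invr_ge0 ?(ltW pgt0)// ?nnegrE ?powR_ge0//.
    by rewrite -lee_fin fineK//; exact: le_trans (G0 0%N t I) (Gle _).
  by rewrite -lee_fin fineK//; exact: Gle.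
have cf : cvgn (series (fun k => f k t)).
  apply: normed_cvg.
  have -> : [normed series (fun k => f k t)] = g ^~ t.
    by apply/funext => n; exact: big_mkord.
  apply: nondecreasing_is_cvgn; first exact: gnd.
  by exists (fine (limn (G ^~ t)) `^ p^-1) => _ [n _ <-]; exact: gbd.
have E : (fun n => Lp_repr (x n) t) =
    (fun n => Lp_repr (x 0%N) t + series (fun k => f k t) n).
  apply/funext => n; rewrite seriesEnat /=.
  rewrite (@telescope_sumr_eq _ _ _ (fun k => Lp_repr (x k) t))//.
  by rewrite addrC subrK.
by rewrite E; apply: is_cvgD => //; exact: is_cvg_cst.
Qed.

(** Riesz-Fischer, norm part: Fatou's lemma bounds the distance of the pointwise
    limit to [x n] by the lower limit of [`|x m - x n|]. *)
Lemma Lp_fast_cauchy (x : nat -> Lpp) :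
  (forall n, `|x n.+1 - x n| <= 2^-1 ^+ n) -> exists y : Lpp, x @ \oo --> y.
Proof.
move=> xfast; have xcvg := ae_cvg_fast_cauchy xfast.
have xdist n m : (n <= m)%N -> `|x m - x n| <= 2 * 2^-1 ^+ n.
  move=> /subnK <-; set k := (m - n)%N.
  suff : `|x (k + n)%N - x n| <= 2 * 2^-1 ^+ n - 2 * 2^-1 ^+ (k + n)%N.
    move/le_trans; apply; rewrite gerBl mulr_ge0// exprn_ge0//.
  elim: k => [|k IH]; first by rewrite add0n !subrr normr0.
  rewrite addSn -(subrKA (x (k + n)%N)) (le_trans (ler_normD _ _))//.
  move: (xfast (k + n)%N) IH; rewrite exprS; lra.
(* An upper limit is measurable whether or not the sequence converges at [t]. *)
pose F t := fine (limn_esup (fun n => (Lp_repr (x n) t)%:E)).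
have mF : measurable_fun setT F.
  apply: (measurableT_comp (fine_measurable measurableT)).
  by apply: measurable_fun_limn_esup => n; exact/measurable_EFinP.
have FE : {ae mu, forall t, Lp_repr (x n) t @[n --> \oo] --> F t}.
  apply: filterS xcvg => t ct; rewrite /F.
  have c' : (Lp_repr (x n) t)%:E @[n --> \oo] -->
      (limn (fun n => Lp_repr (x n) t))%:E.
    by apply: cvg_EFin => //; exact: nearW.
  by rewrite (cvg_limn_einf_sup c').2.
have FN n : ('N[mu]_p%:E[EFin \o (fun t => F t - Lp_repr (x n) t)%R] <=
             (2 * 2^-1 ^+ n)%:E)%E.
  pose h m t := (`|Lp_repr (x m) t - Lp_repr (x n) t| `^ p)%:E.
  have mh m : measurable_fun setT (h m).
    apply/measurable_EFinP.
    apply: (measurableT_comp (measurable_powR _)).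
    by apply: measurableT_comp => //; exact: measurable_funB.
  have h0 m t : setT t -> (0 <= h m t)%E by move=> _; rewrite lee_fin powR_ge0.
  have IF : (\int[mu]_t (`|F t - Lp_repr (x n) t| `^ p)%:E <=
            ((2 * 2^-1 ^+ n) `^ p)%:E)%E.
    have -> : (\int[mu]_t (`|F t - Lp_repr (x n) t| `^ p)%:E =
               \int[mu]_t limn_einf (h ^~ t))%E.
      apply: ge0_ae_eq_integral => //.
      - apply/measurable_EFinP; apply: (measurableT_comp (measurable_powR _)).
        by apply: measurableT_comp => //; exact: measurable_funB.
      - apply: measurableT_comp => //; apply: measurable_fun_limn_esup => m.
        exact: measurableT_comp (mh m).
      - move=> t _; rewrite limn_einf_lim.
        apply: lime_ge; first exact: is_cvg_einfs.
        by apply: nearW => m; apply: le_ereal_inf_tmp => _ [k _ <-]; exact: h0.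
      apply: filterS FE => t Ft _.
      have ht : h m t @[m --> \oo] --> (`|F t - Lp_repr (x n) t| `^ p)%:E.
        apply/cvg_EFin; first exact: nearW.
        by apply: cvg_norm_powR => //; apply: cvgB => //; exact: cvg_cst.
      by rewrite (cvg_limn_einf_sup ht).1.
    apply: le_trans (fatou mu measurableT mh h0) _.
    rewrite limn_einf_lim; apply: lime_le; first exact: is_cvg_einfs.
    apply: nearW => m.
    apply: le_trans (_ : \int[mu]_t h (m + n)%N t <= _)%E.
      by apply: ereal_inf_lbound; exists (m + n)%N => //=; exact: leq_addr.
    rewrite (Lnorm_pow (fun t => Lp_repr (x (m + n)%N) t - Lp_repr (x n) t)).
    rewrite Lp_dist_Lnorm poweR_EFin lee_fin.
    rewrite ge0_ler_powR ?nnegrE ?(ltW pgt0) ?mulr_ge0 ?exprn_ge0//.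
    by rewrite xdist ?leq_addl.
  rewrite Lnorm_pow in IF.
  have : ((('N[mu]_p%:E[EFin \o (fun t => F t - Lp_repr (x n) t)%R] `^ p) `^ p^-1) <=
     ((2 * 2^-1 ^+ n) `^ p)%:E `^ p^-1)%E.
    apply: gt0_ler_poweR => //; rewrite ?invr_ge0 ?(ltW pgt0)//.
      by rewrite in_itv/= leey poweR_ge0.
    by rewrite in_itv/= leey lee_fin powR_ge0.
  rewrite -poweRrM mulfV ?gt_eqF// poweRe1 ?Lnorm_ge0// poweR_EFin -powRrM.
  by rewrite mulfV ?gt_eqF// powRr1 ?mulr_ge0 ?exprn_ge0.
have FB n : (fun t => F t - Lp_repr (x n) t) \in Lfun mu p%:E.
  apply/andP; split; rewrite !inE/=; first exact: measurable_funB.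
  by apply: le_lt_trans (FN n) _; rewrite ltry.
have /choice[g gE] n : exists g : LfunType mu p1,
    g =1 (fun t => F t - Lp_repr (x n) t).
  by exists (Lfun_Sub p1 (FB n)).
(* Only [F - x n] is known to have a finite norm; this yields the class of [F]
   itself, and the same one for every [n]. *)
pose y n : Lpp := Lp_class (g n) + x n.
have yE n : y n = y 0%N.
  rewrite /y -[x n]Lp_reprK -[x 0%N]Lp_reprK -!Lp_classD; congr Lp_class.
  apply/LfuneqP => t.
  rewrite -[LHS]/(g n t + Lp_repr (x n) t) -[RHS]/(g 0%N t + Lp_repr (x 0%N) t).
  by rewrite !gE !subrK.
exists (y 0%N); apply/cvgrPdist_le => e e0.
have : (2 * 2^-1 ^+ n : R) @[n --> \oo] --> (0 : R).
  rewrite -[0 in X in _ --> X](mulr0 2); apply: cvgM; first exact: cvg_cst.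
  by apply: cvg_expr; rewrite ger0_norm; lra.
move=> /cvgrPdist_le/(_ _ e0); apply: filterS => n.
rewrite sub0r normrN ger0_norm ?mulr_ge0 ?exprn_ge0//; apply: le_trans.
rewrite -(yE n) /y addrK -lee_fin Lp_normE finite_norm_fine.
have -> : EFin \o g n = EFin \o (fun t => F t - Lp_repr (x n) t).
  by apply/funext => t /=; rewrite gE.
exact: FN.
Qed.

Lemma Lp_complete (F : set_system Lpp) : ProperFilter F -> cauchy F -> cvg F.
Proof. move=> FF Fc; exact: (complete_of_fast_cauchy Lp_fast_cauchy FF Fc). Qed.

End Lp_complete.

Definition L2_completeNormedModType (R : realType) (d : nat) :
    completeNormedModType R :=
  HB.pack (L2 R d) (Uniform_isComplete.Build (L2 R d)
    (@Lp_complete _ _ R (lebesgue_row d) 2 (lee1n 2))).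

(** * A Gronwall inequality with an exceptional null set *)

Section gronwall.
Context {R : realType}.
Local Notation mu := (@lebesgue_measure R).
Variables (T : R) (phi : R -> R).
Hypothesis phiAC : absolutely_continuous_path T phi.

(** The supremum of this set, the total variation of [phi] over the part of [O]
    in [0, s], is the correction term that absorbs the behaviour of [phi] on an
    exceptional set. *)
Definition variations (O : set R) (s : R) : set R :=
  [set x | exists n (a b : 'I_n -> R),
    [/\ forall i, [/\ 0 <= a i, a i <= b i & b i <= s],
        forall i, `]a i, b i[ `<=` O,
        trivIset setT (fun i => `]a i, b i[%classic)
      & x = \sum_i `|phi (b i) - phi (a i)|]].

Lemma variations0 O s : variations O s 0.
Proof.
exists 0%N, (fun=> 0), (fun=> 0); split; [by case|by case| |by rewrite big_ord0].
by move=> i; case: i.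
Qed.

Lemma variations_le O s s' : s <= s' -> variations O s `<=` variations O s'.
Proof.
move=> ss' x [n [a [b [ab abO tab ->]]]]; exists n, a, b; split=> // i.
by have [? ? ?] := ab i; split=> //; lra.
Qed.

Lemma variations_step O s s' x : 0 <= s -> s <= s' -> `]s, s'[ `<=` O ->
  variations O s x -> variations O s' (x + `|phi s' - phi s|).
Proof.
move=> s0 ss' sO [n [a [b [ab abO tab ->]]]].
pose ext (c : 'I_n -> R) y (i : 'I_n.+1) := oapp c y (unlift ord_max i).
have extS c y i : ext c y (lift ord_max i) = c i by rewrite /ext liftK.
have extM c y : ext c y ord_max = y by rewrite /ext unlift_none.
have liftP i : i = ord_max \/ exists j : 'I_n, i = lift ord_max j.
  by case: (unliftP ord_max i) => [j ->|->]; [right; exists j|left].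
exists n.+1, (ext a s), (ext b s'); split.
- move=> i; have [->|[j ->]] := liftP i; first by rewrite !extM.
  by rewrite !extS; have [? ? ?] := ab j; split=> //; lra.
- by move=> i; have [->|[j ->]] := liftP i; rewrite ?extM ?extS.
- have disj j : `]a j, b j[ `&` `]s, s'[ = set0.
    rewrite -subset0 => y [/=]; rewrite !in_itv/= => /andP[_ yb] /andP[sy _].
    by have [_ _ bs] := ab j; lra.
  apply/trivIsetP => i j _ _; have [->|[i' ->]] := liftP i;
    have [->|[j' ->]] := liftP j; rewrite ?extM ?extS ?eqxx//.
  + by move=> _; rewrite setIC.
  + by rewrite (inj_eq (@lift_inj _ _)) => ij; move/trivIsetP : tab => ->.
- rewrite big_ord_recr /= !extM; congr (_ + _); apply: eq_bigr => i _.
  have -> : widen_ord (leqnSn n) i = lift ord_max i.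
    by apply/ord_inj; rewrite lift_max.
  by rewrite !extS.
Qed.

(** Absolute continuity, with the total length of the intervals bounded by the
    measure of the open set that contains them. *)
Lemma variations_small e : 0 < e -> exists2 delta, 0 < delta &
  forall O s x, open O -> (mu O < delta%:E)%E -> s <= T -> variations O s x -> x < e.
Proof.
move=> /phiAC[delta d0 H]; exists delta => // O s x oO muO sT.
move=> [n [a [b [ab abO tab ->]]]]; apply: H => //.
  by move=> i; have [? ? ?] := ab i; split=> //; lra.
rewrite -lte_fin; apply: le_lt_trans muO.
have mab i : measurable `]a i, b i[%classic by [].
have -> : ((\sum_i (b i - a i))%:E = \sum_(i < n) mu `]a i, b i[%classic)%E.
  rewrite -sumEFin; apply: eq_bigr => i _.
  rewrite lebesgue_measure_itv/= lte_fin; case: ltP => // ba.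
  by have [_ ? _] := ab i; congr EFin; lra.
have -> : \sum_(i < n) mu `]a i, b i[%classic =
    \sum_(i \in [set` xpredT]) mu `]a i, b i[%classic.
  by apply: bigfs; [exact: index_enum_uniq|move=> i _; rewrite mem_index_enum].
have -> : [set` xpredT] = [set: 'I_n] by apply/seteqP.
rewrite -measure_fin_bigcup//.
apply: le_measure; rewrite ?inE.
- apply: fin_bigcup_measurable => [|i _]; first exact: finite_finset.
  exact: measurable_itv.
- exact: open_measurable.
- exact: bigcup_sub.
- exact: finite_finset.
Qed.

Lemma ac_uniform e : 0 < e -> exists2 delta, 0 < delta &
  forall x y, 0 <= x -> x <= y -> y <= T -> y - x < delta -> `|phi y - phi x| < e.
Proof.
move=> /phiAC[delta d0 H]; exists delta => // x y x0 xy yT yx.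
have := H 1%N (fun=> x) (fun=> y); rewrite !big_ord1; apply => //.
by move=> i j _ _ _; rewrite !ord1.
Qed.

(** The bound is propagated from left to right in the form
    [phi s <= e^(K s) ((B + eta) s + th s)], where [th s] is the variation of
    [phi] over the part in [0, s] of a small open set [O] that contains the
    exceptional null set. Outside [O] the differential inequality carries it to
    the right of [s]; inside [O] the growth of [phi] is at most that of [th].
    The bound passes to limits from the left because [phi] is continuous and
    [th] is nondecreasing. In the end [th t <= eta], and [eta] is arbitrary. *)
Lemma gronwall_ae (K B : R) : 0 <= K -> 0 <= B -> phi 0 <= 0 ->
  {ae mu, forall t, `]0, T[%classic t -> forall A, B < A ->
     \forall h \near 0^'+, phi (t + h) <= expR (K * h) * phi t + h * A} ->
  forall t, 0 <= t -> t <= T -> phi t <= expR (K * t) * (B * t).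
Proof.
move=> K0 B0 phi0 [N [mN N0 subN]] t t0 tT.
suff main eta : 0 < eta -> phi t <= expR (K * t) * ((B + eta) * t + eta).
  apply/ler_addgt0Pr => e e0.
  have E0 : 0 < expR (K * t) := expR_gt0 _.
  have t1 : 0 < expR (K * t) * (t + 1) by rewrite mulr_gt0//; lra.
  have /main : 0 < e / (expR (K * t) * (t + 1)) by rewrite divr_gt0.
  set et := (e / _) => h; have : et * (expR (K * t) * (t + 1)) = e.
    by rewrite /et divfK// gt_eqF.
  by move=> et1; rewrite -et1; lra.
move=> eta0; have [delta d0 small] := variations_small eta0.
(* The point 0 is covered too, as the hypothesis is only about the open interval. *)
pose D : set R := N `|` [set 0].
have mD : measurable D by apply: measurableU.
have muD0 : mu D = 0%E.
  by rewrite measureU0//; exact: lebesgue_measure_set1.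
have [ O [oO DO muO]] : exists O, [/\ open O, D `<=` O &
    (mu O < delta%:E)%E].
  have muDoo : (mu D < +oo)%E by rewrite muD0.
  have [ O [oO DO muO]] := lebesgue_regularity_outer mD muDoo d0.
  exists O; split => //; apply: le_lt_trans muO.
  rewrite -[in leRHS](@measureU0 _ _ _ mu _ _ _ mD muD0); last first.
    by apply: measurableD => //; exact: open_measurable.
  by rewrite setUC setDUK.
pose th s := sup (variations O s).
have ubv s : s <= T -> has_sup (variations O s).
  move=> sT; split; first by exists 0; exact: variations0.
  by exists eta => x xv; apply/ltW; exact: small muO sT xv.
have th0 s : s <= T -> 0 <= th s.
  by move=> sT; apply: sup_upper_bound (variations0 _ _); exact: ubv.
have th_eta s : s <= T -> th s <= eta.
  move=> sT; apply: ge_sup; first by exists 0; exact: variations0.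
  by move=> x xv; apply/ltW; exact: small muO sT xv.
have th_le s s' : s <= s' -> s' <= T -> th s <= th s'.
  move=> ss' sT; apply: ge_sup; first by exists 0; exact: variations0.
  by move=> x xv; apply: sup_upper_bound; [exact: ubv|exact: variations_le xv].
have th_step s s' : 0 <= s -> s <= s' -> s' <= T -> `]s, s'[ `<=` O ->
    th s + `|phi s' - phi s| <= th s'.
  move=> s0 ss' sT sO; rewrite -lerBrDr.
  apply: ge_sup; first by exists 0; exact: variations0.
  move=> x xv; rewrite lerBrDr; apply: sup_upper_bound; first exact: ubv.
  exact: variations_step.
pose A := B + eta.
pose good s := phi s <= expR (K * s) * (A * s + th s).
suff gt : good t.
  apply: le_trans gt _; rewrite ler_pM2l ?expR_gt0// lerD2l.
  exact: th_eta.
have A0 : 0 <= A by rewrite /A; lra.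
have bound_le r s : 0 <= r -> r <= s -> s <= T ->
    expR (K * r) * (A * r + th r) <= expR (K * s) * (A * s + th s).
  move=> r0 rs sT; apply: ler_pM; rewrite ?expR_ge0//.
  - by rewrite addr_ge0 ?mulr_ge0// th0//; lra.
  - by rewrite ler_expR ler_wpM2l.
  - by rewrite lerD ?th_le// ler_wpM2l.
have advance s : 0 <= s -> s < t -> good s -> \forall h \near 0^'+, good (s + h).
  move=> s0 st gs.
  have hT : \forall h \near 0^'+, 0 < h /\ s + h <= T.
    near=> h; split; first by near: h; exact: nbhs_right_gt.
    have : h <= T - s by near: h; apply: nbhs_right_le; lra.
    lra.
  have [sO|sO] := pselect (O s).
    have : \forall h \near 0^'+, `]s, s + h[ `<=` O.
      have /nbhs_ballP[r /= r0 rO] : nbhs s O by exact: open_nbhs_nbhs.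
      near=> h => y /=; rewrite in_itv/= => /andP[sy ys]; apply: rO.
      rewrite -ball_normE /= distrC ger0_norm ?subr_ge0 ?ltW//.
      have : h < r by near: h; exact: nbhs_right_lt.
      lra.
    apply: filterS2 hT => h [h0 hT] hO; rewrite /good.
    have step := th_step s (s + h) s0 _ hT hO.
    have {}step : phi (s + h) - phi s <= th (s + h) - th s.
      have := step ltac:(lra); have := ler_norm (phi (s + h) - phi s); lra.
    have sT : s <= T by lra.
    have e1 : 1 <= expR (K * (s + h)).
      by rewrite -[leLHS](@expR0 R) ler_expR mulr_ge0//; lra.
    have dth : 0 <= th (s + h) - th s by rewrite subr_ge0 th_le//; lra.
    have e2 : expR (K * s) <= expR (K * (s + h)).
      by rewrite ler_expR ler_wpM2l//; lra.
    apply: le_trans (_ : expR (K * s) * (A * s + th s) + (th (s + h) - th s) <= _).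
      by rewrite /good in gs; lra.
    apply: (@le_trans _ _ (expR (K * (s + h)) * (A * s + th s) +
        expR (K * (s + h)) * (th (s + h) - th s))).
      rewrite lerD// ?ler_peMl//.
      by rewrite ler_wpM2r// addr_ge0 ?mulr_ge0 ?th0.
    rewrite -mulrDr ler_pM2l ?expR_gt0//.
    have : 0 <= A * h by rewrite mulr_ge0//; lra.
    lra.
  have s0' : 0 < s.
    rewrite lt_neqAle s0 andbT; apply/eqP => s00; apply: sO; apply: DO.
    by right; rewrite /= s00.
  have Ps : \forall h \near 0^'+, phi (s + h) <= expR (K * h) * phi s + h * A.
    have : (~` N) s by move=> Ns; apply: sO; apply: DO; left.
    move=> /(@subsetC _ _ _ subN); rewrite setCK; apply.
      by rewrite /= in_itv/= s0'; lra.
    by rewrite /A; lra.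
  apply: filterS2 hT Ps => h [h0 hT] Ps; rewrite /good.
  apply: le_trans Ps _.
  have ss : th s <= th (s + h) by apply: th_le; lra.
  have e1 : 1 <= expR (K * (s + h)).
    by rewrite -[leLHS](@expR0 R) ler_expR mulr_ge0//; lra.
  have -> : expR (K * (s + h)) * (A * (s + h) + th (s + h)) =
     expR (K * h) * (expR (K * s) * (A * s + th (s + h))) + expR (K * (s + h)) * (h * A).
    by rewrite !(mulrDr K) !expRD; lra.
  rewrite lerD// ?ler_peMl ?mulr_ge0//; last lra.
  rewrite ler_pM2l ?expR_gt0//; apply: le_trans gs _.
  by rewrite ler_pM2l ?expR_gt0// lerD2l.
(* Continuous induction: [sup S] is good, and [advance] would move past it. *)
pose S := [set s | 0 <= s /\ s <= t /\ forall r, 0 <= r -> r <= s -> good r].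
have S0 : S 0.
  split=> //; split=> // r r0 r0'.
  have -> : r = 0 by lra.
  rewrite /good mulr0 expR0 mul1r mulr0 add0r (le_trans phi0)// th0//; lra.
have supS : has_sup S.
  by split; [exists 0|exists t => s [_ []]].
set c := sup S.
have c0 : 0 <= c by exact: sup_upper_bound.
have ct : c <= t by apply: ge_sup; [exists 0|move=> s [_ []]].
have below r : 0 <= r -> r < c -> good r.
  move=> r0 rc; have [s [s0 [st sg]] rs] := sup_gt (proj1 supS) rc.
  exact/sg/ltW.
have gc : good c.
  have [c00|c00] := eqVneq c 0.
    by rewrite c00; case: S0 => _ [_]; apply.
  have {c00} c00 : 0 < c by rewrite lt_neqAle eq_sym c00.
  apply/ler_addgt0Pr => e e0.
  have [dl dl0 unif] := ac_uniform e0.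
  pose r := Num.max (c / 2) (c - dl / 2).
  have r0 : 0 <= r by rewrite le_max; apply/orP; left; lra.
  have rc : r < c by rewrite gt_max; apply/andP; split; lra.
  have rd : c - r < dl.
    have : c - dl / 2 <= r by rewrite le_max lexx orbT.
    lra.
  have := unif r c r0 (ltW rc) ltac:(lra) rd.
  have := ler_norm (phi c - phi r).
  have := below r r0 rc; rewrite /good.
  have := @bound_le r c r0 (ltW rc) ltac:(lra).
  lra.
have [<-//|ct'] := eqVneq c t.
have {}ct' : c < t by rewrite lt_neqAle ct'.
exfalso.
have /(nbhs_right0P c good)/nbhs_ballP[r /= r0 rgood] := advance c c0 ct' gc.
pose s := Num.min (c + r / 2) t.
have cs : c < s by rewrite lt_min ct' andbT; lra.
have Ss : S s.
  split; first lra; split; first by rewrite ge_min lexx orbT.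
  move=> y y0 ys; have [yc|cy|->//] := ltgtP y c; first exact: below.
  apply: (rgood y _ cy); rewrite -ball_normE /= distrC ger0_norm ?subr_ge0 ?ltW//.
  have : s <= c + r / 2 by rewrite ge_min lexx.
  lra.
have := sup_upper_bound supS Ss; rewrite -/c; lra.
Unshelve. all: by end_near. Qed.
End gronwall.

(** * Strongly continuous semigroups *)

Section semigroup_bound.
Context {R : realType}.

(** Otherwise there are times [t_n] tending to 0 with [|S t_n| > n + 1]. Strong
    continuity at 0 bounds each orbit [S t_n x], so this contradicts the uniform
    boundedness principle. *)
Lemma semigroup_bounded_near0 (V : completeNormedModType R) (S : R -> V -> V) :
  C0_semigroup S -> exists delta M : R, [/\ 0 < delta, 1 <= M &
    forall t x, 0 <= t -> t <= delta -> `|S t x| <= M * `|x|].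
Proof.
move=> [Slin S0 SD Scont]; apply: contrapT => H.
have /choice[tx txP] n : exists tx : R * V, [/\ 0 <= tx.1, tx.1 <= n.+1%:R^-1 &
    n.+1%:R * `|tx.2| < `|S tx.1 tx.2|].
  apply: contrapT => H'; apply: H; exists n.+1%:R^-1, n.+1%:R.
  split; rewrite ?invr_gt0 ?ltr0n ?ler1n// => t x t0 tn.
  by rewrite leNgt; apply/negP => tx; apply: H'; exists (t, x).
pose F := [set S (tx n).1 | n in [set: nat]].
have FP f : F f -> bounded_fun_norm f /\ linear f.
  move=> [n _ <-]; have [t0 _ _] := txP n.
  have [lin cont] := Slin _ t0; split=> //.
  pose f' : {linear V -> V} := HB.pack (S (tx n).1) (GRing.isLinear.Build _ _ _ _ _ lin).
  have : bounded_near f' (nbhs (0 : V)) by apply/linear_bounded_continuous.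
  by move=> /bounded_funP.
have Fpt : pointwise_bounded F.
  move=> x; have /cvgrPdist_lt/(_ _ ltr01) := Scont x.
  move=> /nbhs_ballP[r /= r0 rx].
  have [N Nr] : exists N, forall n, (N <= n)%N -> n.+1%:R^-1 < r.
    exists (Num.trunc r^-1) => n Nn.
    rewrite invf_plt ?posrE ?ltr0n//.
    by apply: lt_le_trans (truncnS_gt _) _; rewrite ler_nat.
  (* The sum covers the finitely many times that are not yet close to 0. *)
  exists (\sum_(n < N) `|S (tx n).1 x| + (`|x| + 1)) => _ [n _ <-].
  have s0 : 0 <= \sum_(n < N) `|S (tx n).1 x| by exact: sumr_ge0.
  have [nN|Nn] := ltnP n N.
    rewrite (bigD1 (Ordinal nN))//= -addrA lerDl addr_ge0 ?sumr_ge0 ?addr_ge0//.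
  have [t0 tn _] := txP n.
  rewrite (@le_trans _ _ (`|x| + 1))// ?lerDr//.
  have [->|tn0] := eqVneq (tx n).1 0; first by rewrite S0 lerDl.
  have : `|x - S (tx n).1 x| < 1.
    apply: (rx (tx n).1); last by rewrite lt_neqAle eq_sym tn0.
    rewrite -ball_normE /= sub0r normrN ger0_norm//.
    exact: le_lt_trans tn (Nr _ Nn).
  have := ler_normB x (x - S (tx n).1 x); rewrite subKr; lra.
have [M FM] := Banach_Steinhauss FP Fpt 1.
pose n := Num.trunc M.
have [t0 _ Sx] := txP n; have [lin _] := Slin _ t0.
pose f' : {linear V -> V} := HB.pack (S (tx n).1) (GRing.isLinear.Build _ _ _ _ _ lin).
have Sf : S (tx n).1 = f' by [].
have x0 : 0 < `|(tx n).2|.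
  rewrite normr_gt0; apply: contraTneq Sx => ->.
  by rewrite Sf linear0 !normr0 mulr0 ltxx.
have := FM (S (tx n).1) _ (`|(tx n).2|^-1 *: (tx n).2).
rewrite Sf linearZ !normrZ normfV normr_id mulVf ?gt_eqF// -Sf.
move=> /(_ _ (lexx 1)); rewrite ler_pdivrMl// => SM.
have : `|S (tx n).1 (tx n).2| <= `|(tx n).2| * M by apply: SM; exists n.
apply/negP; rewrite -ltNge; apply: le_lt_trans Sx.
by rewrite mulrC ler_pM2r// ltW// truncnS_gt.
Qed.

(** A time [t] is reached in at most [t / delta + 1] steps of length [delta], each
    of which costs a factor [M]; hence the rate [w = ln M / delta]. *)
Lemma semigroup_exp_bounded (V : completeNormedModType R) (S : R -> V -> V) :
  C0_semigroup S -> exists M w : R, [/\ 1 <= M, 0 <= w &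
    forall t x, 0 <= t -> `|S t x| <= M * expR (w * t) * `|x|].
Proof.
move=> SC; have [delta [M [d0 M1 SM]]] := semigroup_bounded_near0 SC.
have [_ _ SD _] := SC.
have M0 : 0 < M by lra.
have Spow n t x : 0 <= t -> t <= n%:R * delta -> `|S t x| <= M ^+ n * `|x|.
  elim: n t x => [|n IH] t x t0 tn.
    have -> : t = 0 by lra.
    by case: SC => _ -> _ _; rewrite mul1r.
  have Mn : 1 <= M ^+ n by rewrite exprn_ege1.
  have [td|td] := leP t delta.
    apply: (le_trans (SM _ _ t0 td)).
    by rewrite exprS -mulrA ler_pM2l// ler_peMl.
  have -> : t = delta + (t - delta) by lra.
  rewrite SD/=; [|lra|lra].
  apply: (le_trans (SM _ _ _ _)); [lra|lra|].
  rewrite exprS -mulrA ler_pM2l//; apply: IH; first lra.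
  move: tn; rewrite -natr1 mulrDl; lra.
have lM : 0 <= ln M by rewrite ln_ge0.
exists M, (ln M / delta); split => //; first by rewrite divr_ge0// ltW.
move=> t x t0; have td0 : 0 <= t / delta by rewrite divr_ge0// ltW.
pose n := Num.trunc (t / delta).
have tn : t <= n.+1%:R * delta by rewrite -ler_pdivrMr// ltW// truncnS_gt.
apply: (le_trans (Spow _ _ _ t0 tn)); rewrite ler_wpM2r//.
rewrite exprS ler_pM2l// -[in leLHS](@lnK _ M)// -expRM_natl ler_expR.
have -> : ln M / delta * t = t / delta * ln M by lra.
by rewrite ler_wpM2r// truncn_le.
Qed.

(** Feller's renorming [nu x = sup_t e^(- w t) |S t x|]: it removes the constant
    [M], which an infinitesimal argument could not tolerate as it would be paid
    at every step. *)
Lemma semigroup_adapted_norm (V : completeNormedModType R) (S : R -> V -> V) :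
  C0_semigroup S -> exists (M w : R) (nu : V -> R), [/\ 0 < M, 0 <= w,
    forall x, `|x| <= nu x <= M * `|x|,
    forall x y, nu (x + y) <= nu x + nu y &
    forall h x, 0 <= h -> nu (S h x) <= expR (w * h) * nu x].
Proof.
move=> SC; have [M [w [M1 w0 SM]]] := semigroup_exp_bounded SC.
have [Slin S0 SD _] := SC.
pose orb x := [set expR (- (w * t)) * `|S t x| | t in [set t | 0 <= t]].
have orbne x : orb x !=set0 by exists (expR (- (w * 0)) * `|S 0 x|); exists 0 => /=.
have orbM x : ubound (orb x) (M * `|x|).
  move=> _ [t t0 <-]; rewrite expRN ler_pdivrMl ?expR_gt0//.
  by apply: (le_trans (SM t x t0)); rewrite mulrA [expR _ * M]mulrC.
have orbs x : has_sup (orb x) by split=> //; exists (M * `|x|).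
have orble x t : 0 <= t -> expR (- (w * t)) * `|S t x| <= sup (orb x).
  by move=> t0; apply: sup_upper_bound => //; exists t.
exists M, w, (fun x => sup (orb x)); split => //; first lra.
- move=> x; apply/andP; split; last exact: ge_sup.
  by have := orble x 0 (lexx 0); rewrite mulr0 oppr0 expR0 mul1r S0.
- move=> x y; apply: ge_sup => // _ [t t0 <-].
  apply: (@le_trans _ _ (expR (- (w * t)) * `|S t x| + expR (- (w * t)) * `|S t y|)).
    have [lin _] := Slin _ t0; have := lin 1 x y; rewrite !scale1r => ->.
    by rewrite -mulrDr ler_pM2l ?expR_gt0// ler_normD.
  by rewrite lerD// orble.
- move=> h x h0; apply: ge_sup => // _ [t /= t0 <-].
  rewrite -ler_pdivrMl ?expR_gt0// -expRN mulrA -expRD.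
  have -> : - (w * h) - w * t = - (w * (t + h)) by lra.
  have <- : S (t + h) x = S t (S h x) by rewrite SD.
  by apply: orble; rewrite addr_ge0.
Qed.

End semigroup_bound.

(** * Stability of strong solutions *)

(** [nu o W] satisfies the hypotheses of [gronwall_ae]: the difference
    [W (s + h) - S h (W s)] is [h (W' s - L (W s))] up to [o(h)], and [S h] costs
    no more than [e^(w h)] in the norm [nu]. *)
Lemma semigroup_evolution_estimate (R : realType) (V : completeNormedModType R)
    (D : set V) (L : V -> V) : generates_C0_semigroup D L ->
  exists M w : R, [/\ 0 < M, 0 <= w &
  forall (T Q B : R) (W : R -> V), 0 <= Q -> 0 <= B ->
    absolutely_continuous_path T W -> W 0 = 0 ->
    {ae lebesgue_measure, forall t, `]0, T[%classic t ->
       [/\ D (W t), derivable W t 1 &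
           `|(W^`())%classic t - L (W t)| <= Q * `|W t| + B]} ->
    forall t, 0 <= t -> t <= T ->
      `|W t| <= expR ((w + M * Q) * t) * (M * B * t)].
Proof.
move=> [S [SC [_ gen]]].
have [M [w [nu [M0 w0 nuM nuD nuS]]]] := semigroup_adapted_norm SC.
have nul x : `|x| <= nu x by have /andP[] := nuM x.
have nuu x : nu x <= M * `|x| by have /andP[] := nuM x.
exists M, w; split=> // T Q B W Q0 B0 WAC W0 Wae t t0 tT.
apply: le_trans (nul _) _.
apply: (@gronwall_ae R T (nu \o W)) => //.
- move=> e e0; have eM : 0 < e / M by rewrite divr_gt0.
  have [delta d0 H] := WAC _ eM; exists delta => // n a b ab tab sab.
  have := H n a b ab tab sab; rewrite ltr_pdivlMr// mulrC; apply: le_lt_trans.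
  rewrite mulr_sumr; apply: ler_sum => i _ /=.
  rewrite ler_norml; apply/andP; split.
    have := nuD (W (a i) - W (b i)) (W (b i)); rewrite subrK.
    have := nuu (W (a i) - W (b i)); rewrite distrC; lra.
  have := nuD (W (b i) - W (a i)) (W (a i)); rewrite subrK.
  have := nuu (W (b i) - W (a i)); lra.
- by rewrite addr_ge0// mulr_ge0// ltW.
- by rewrite mulr_ge0// ltW.
- by rewrite /= W0; have := nuu 0; rewrite normr0 mulr0.
apply: (@filterS _ _ (ae_filter_ringOfSetsType _) _ _ _ Wae) => s1 + sT A MBA.
move=> /(_ sT); set s : R := s1 => -[DWs drv est].
(* The two first-order remainders, of size [h e] each, use up the gap [A - M B]. *)
pose e := (A - M * B) / (2 * M).
have e0 : 0 < e by rewrite divr_gt0 ?mulr_gt0//; lra.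
have eE : 2 * M * e = A - M * B by rewrite /e mulrC divfK// gt_eqF// mulr_gt0.
have /cvgrPdist_le/(_ _ e0) genS := gen _ DWs.
have genW : \forall h \near 0^'+, `|(W^`())%classic s - h^-1 *: (W (s + h) - W s)| <= e.
  have /cvgrPdist_le/(_ _ e0)/nbhs_ballP[r /= r0 rW] := drv.
  apply/nbhs_ballP; exists r => //= h hr h0.
  have /= := rW h hr; rewrite derive1E /derive [h%:A]scaler1 [h + s]addrC /=; apply.
  by rewrite gt_eqF.
have h0 : \forall h \near 0^'+, (0 : R) < h by exact: nbhs_right_gt.
near=> h.
have hp : 0 < h by near: h.
have gS : `|L (W s) - h^-1 *: (S h (W s) - W s)| <= e by near: h.
have gW : `|(W^`())%classic s - h^-1 *: (W (s + h) - W s)| <= e by near: h.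
have hn (y x : V) : `|y - h^-1 *: x| <= e -> `|x - h *: y| <= h * e.
  move=> yx; have -> : x - h *: y = - h *: (y - h^-1 *: x).
    by rewrite scalerBr scalerA mulNr mulfV ?gt_eqF// scaleN1r opprK scaleNr addrC.
  by rewrite normrZ normrN gtr0_norm// ler_pM2l.
have {}gS := hn _ _ gS; have {}gW := hn _ _ gW.
have split : W (s + h) - S h (W s) = (W (s + h) - W s - h *: (W^`())%classic s)
   - (S h (W s) - W s - h *: L (W s)) + h *: ((W^`())%classic s - L (W s)).
  rewrite scalerBr addrAC subrKA -!(addrA _ (- W s)).
  by rewrite opprD addrACA subrr addr0.
have dist : `|W (s + h) - S h (W s)| <= h * e + h * e + h * (Q * `|W s| + B).
  rewrite split (le_trans (ler_normD _ _))// lerD//.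
    by rewrite (le_trans (ler_normB _ _))// lerD.
  by rewrite normrZ gtr0_norm// ler_pM2l.
have : (nu \o W) (s + h) <= expR (w * h) * nu (W s) +
     M * (h * e + h * e + h * (Q * nu (W s) + B)).
  have := nuD (W (s + h) - S h (W s)) (S h (W s)); rewrite subrK /=.
  have := nuS h (W s) (ltW hp); have := nuu (W (s + h) - S h (W s)).
  have : M * `|W (s + h) - S h (W s)| <=
         M * (h * e + h * e + h * (Q * nu (W s) + B)).
    rewrite ler_pM2l//; apply: (le_trans dist).
    by rewrite lerD2l// ler_pM2l// lerD2r ler_wpM2l.
  lra.
move/le_trans; apply.
have -> : M * (h * e + h * e + h * (Q * nu (W s) + B)) =
    h * (2 * M * e) + h * (M * B) + h * (M * Q) * nu (W s) by lra.
rewrite eE /=.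
have nu0 : 0 <= nu (W s) := le_trans (normr_ge0 _) (nul _).
have : expR (w * h) + h * (M * Q) <= expR ((w + M * Q) * h).
  rewrite mulrDl expRD.
  have : 1 <= expR (w * h) by rewrite -[leLHS](@expR0 R) ler_expR mulr_ge0// ltW.
  have := expR_ge1Dx (M * Q * h).
  have : 0 <= M * Q * h by rewrite !mulr_ge0// ltW.
  nra.
move=> /(ler_wpM2r nu0); lra.
Unshelve. all: by end_near. Qed.

(** The source [f] and the datum [g] cancel in [W = u - u'], and
    [P u - P' u' = (P u - P u') + (P u' - P' u')] is bounded by
    [Q |W| + q b]. *)
Lemma strong_solution_stability (R : realType) (V : completeNormedModType R)
    (D : set V) (L : V -> V) :
  linear_operator D L -> generates_C0_semigroup D L ->
  exists M w : R, [/\ 0 < M, 0 <= w &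
  forall (T Q q b : R) (P P' : V -> V) (f : R -> V) (g : V) (u u' : R -> V),
    0 <= Q -> 0 <= q ->
    (forall x y, `|P x - P y| <= Q * `|x - y|) ->
    (forall x, `|P x - P' x| <= q * `|x|) ->
    strong_solution T D L P f g u -> strong_solution T D L P' f g u' ->
    (forall t, 0 <= t -> t <= T -> `|u' t| <= b) ->
    forall t, 0 <= t -> t <= T ->
      `|u t - u' t| <= expR ((w + M * Q) * T) * (M * T) * q * b].
Proof.
move=> [D0 DL] /semigroup_evolution_estimate[M [w [M0 w0 est]]].
exists M, w; split=> // T Q q b P P' f g u u' Q0 q0 PQ PP' su su' ub t t0 tT.
have b0 : 0 <= b by apply: le_trans (normr_ge0 _) (ub t t0 tT).
have T0 : 0 <= T by lra.
have qb0 : 0 <= q * b by rewrite mulr_ge0.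
case: su => [[_ uD] [uAC uder] _ ueq u0].
case: su' => [[_ uD'] [uAC' uder'] _ ueq' u0'].
have sub4 (x y z v : V) : (x - y) - (z - v) = (x - z) - (y - v).
  by rewrite !opprB addrACA [RHS]addrACA [- y - z]addrC.
pose W s := u s - u' s.
have WAC : absolutely_continuous_path T W.
  move=> e e0; have e2 : 0 < e / 2 by lra.
  have [d1 d10 H1] := uAC _ e2; have [d2 d20 H2] := uAC' _ e2.
  exists (Num.min d1 d2); first by rewrite lt_min d10.
  move=> n x y xy txy; rewrite lt_min => /andP[s1 s2].
  have {}H1 := H1 n x y xy txy s1; have {}H2 := H2 n x y xy txy s2.
  apply: (@le_lt_trans _ _ (\sum_i `|u (y i) - u (x i)| +
      \sum_i `|u' (y i) - u' (x i)|)).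
    rewrite -big_split /=; apply: ler_sum => i _.
    by rewrite /W sub4 (le_trans (ler_normB _ _)).
  lra.
have Wae : {ae lebesgue_measure, forall s, `]0, T[%classic s ->
    [/\ D (W s), derivable W s 1 &
        `|(W^`())%classic s - L (W s)| <= Q * `|W s| + q * b]}.
  apply: (@filterS2 _ _ (ae_filter_ringOfSetsType _) _ _ _ _
    (@filterI _ _ (ae_filter_ringOfSetsType _) _ _ uder uder')
    (@filterI _ _ (ae_filter_ringOfSetsType _) _ _ ueq ueq')).
  move=> s1 [/= d1 d2] [e1 e2] sT; move: (d1 sT) (d2 sT) (e1 sT) (e2 sT).
  set s : R := s1 => {d1 d2 e1 e2} du du' eu eu'.
  have [s0 sT'] : 0 <= s /\ s <= T.
    by move: sT; rewrite /= in_itv/= => /andP[/ltW ? /ltW ?].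
  have sI : s \in `[0, T] by rewrite in_itv/= s0.
  have [DW LW] := DL (-1) _ _ (uD' s sI) (uD s sI).
  have WE : -1 *: u' s + u s = W s by rewrite scaleN1r addrC.
  rewrite WE in DW LW; split => //; first exact: derivableB.
  have -> : (W^`())%classic s = (u^`())%classic s - (u'^`())%classic s.
    by rewrite !derive1E deriveB.
  have -> : (u^`())%classic s = f s + L (u s) - P (u s).
    by rewrite -eu addrAC addrK subrK.
  have -> : (u'^`())%classic s = f s + L (u' s) - P' (u' s).
    by rewrite -eu' addrAC addrK subrK.
  have fK : (f s + L (u s)) - (f s + L (u' s)) = L (u s) - L (u' s).
    by rewrite opprD addrACA subrr add0r.
  rewrite LW scaleN1r [- L _ + _]addrC (sub4 (f s + L (u s))) fK.
  rewrite addrAC subrr add0r normrN -(subrKA (P (u' s))).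
  apply: (le_trans (ler_normD _ _)); apply: lerD; first exact: PQ.
  by apply: (le_trans (PP' _)); rewrite ler_wpM2l// ub.
have := est T Q (q * b) W Q0 qb0 WAC _ Wae t t0 tT.
rewrite /W u0 u0' subrr => /(_ erefl)/le_trans; apply.
have -> : expR ((w + M * Q) * T) * (M * T) * q * b =
  expR ((w + M * Q) * T) * (M * (q * b) * T) by lra.
have Mqb : 0 <= M * (q * b) by rewrite mulr_ge0// ltW.
apply: ler_pM; rewrite ?expR_ge0 ?mulr_ge0 ?(ltW M0)//.
  by rewrite ler_expR ler_wpM2l// addr_ge0// mulr_ge0// ltW.
by rewrite ler_wpM2l.
Qed.

(** * Multiplication by a bounded potential on L^p *)

(** An open set is the countable union of the cubes with rational centre and
    radius [1 / (k + 1)] that it contains, and a cube is a finite intersection of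
    preimages under coordinates. *)
Lemma open_measurable_row (R : realType) d (A : set 'rV[R]_d) :
  open A -> measurable A.
Proof.
move=> oA.
pose B (c : 'rV[rat]_d) (k : nat) : set 'rV[R]_d :=
  [set y | forall i, `|ratr (c ord0 i) - y ord0 i| < k.+1%:R^-1].
have mB c k : measurable (B c k).
  have -> : B c k = \bigcap_(i in [set: 'I_d])
      ((fun y : 'rV[R]_d => y ord0 i) @^-1` ball (ratr (c ord0 i) : R) k.+1%:R^-1).
    apply/seteqP; split => [y Bcy i _|y Bcy i].
      by rewrite /= -ball_normE /=; exact: Bcy.
    by have := Bcy i I; rewrite /= -ball_normE.
  apply: fin_bigcap_measurable; first exact: finite_finset.
  move=> i _; rewrite -[X in measurable X]setTI.
  by apply: measurable_row_coord => //; exact: measurable_ball.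
pose P (n : nat) : set 'rV[R]_d :=
  if choice.unpickle n is Some (c, k) then
    if `[< B c k `<=` A >] then B c k else set0
  else set0.
have -> : A = \bigcup_n P n.
  apply/seteqP; split => [x Ax|x [n _]]; last first.
    rewrite /P; case: (choice.unpickle n) => // -[c k].
    by case: asboolP => // BA; exact: BA.
  have /nbhs_ballP[e /= e0 eA] : nbhs x A by exact: open_nbhs_nbhs.
  have [k k0 ke] : exists2 k : nat, 0 < k.+1%:R^-1 :> R & 2 * k.+1%:R^-1 < e.
    exists (Num.trunc (2 / e)); first by rewrite invr_gt0.
    rewrite -ltr_pdivlMr ?invr_gt0// invrK mulrC -ltr_pdivrMr//.
    exact: truncnS_gt.
  have /choice[c cP] i : exists q : rat, `|ratr q - x ord0 i| < k.+1%:R^-1 :> R.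
    have : x ord0 i - k.+1%:R^-1 < x ord0 i + k.+1%:R^-1.
      by rewrite ltrBlDr -addrA ltrDl addr_gt0.
    move=> /rat_in_itvoo[q]; rewrite in_itv/= => /andP[q1 q2]; exists q.
    by rewrite ltr_norml ltrBrDl q1 ltrBlDl q2.
  exists (choice.pickle (\row_i c i, k)) => //; rewrite /P choice.pickleK.
  have -> : `[< B (\row_i c i) k `<=` A >].
    apply/asboolP => y By; apply: eA; split => // i j; rewrite !ord1.
    rewrite -ball_normE /=; have := By j; rewrite mxE => yj.
    have := cP j; rewrite distrC => xj.
    rewrite -(subrKA (ratr (c j))) (le_lt_trans (ler_normD _ _))//.
    by apply: lt_trans ke; rewrite mulr_natl mulr2n ltrD.
  by move=> i; rewrite mxE.
apply: bigcupT_measurable => n; rewrite /P.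
case: (choice.unpickle n) => [[c k]|]; last exact: measurable0.
by case: ifP => _; [exact: mB|exact: measurable0].
Qed.

Lemma continuous_measurable_row (R : realType) d (r : 'rV[R]_d -> R) :
  continuous r -> measurable_fun [set: 'rV[R]_d] r.
Proof.
move=> cr; apply: (measurability (@RGenOpens.G R) (RGenOpens.measurableE R)).
move=> _ [_ [a [b ->]] <-].
rewrite setTI; apply: open_measurable_row.
by apply: open_comp => // x _; exact: cr.
Qed.

Section potential.
Context d (T : measurableType d) (R : realType).
Variables (mu : {measure set T -> \bar R}).

(** The supremum norm is set to 0 on a space of measure zero; there every
    property holds almost everywhere. *)
Lemma Linfty_ae (r : T -> R) (M : R) :
  ('N[mu]_+oo[EFin \o r] <= M%:E)%E -> {ae mu, forall x, `|r x| <= M}.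
Proof.
rewrite unlock /Lnorm; case: ifPn => [_ /ess_supP|mu0 _]; first exact.
apply: (@negligibleS _ _ _ mu setT) => //; exists setT; split => //.
by apply/eqP; rewrite -measure_le0 leNgt.
Qed.

Variable p : R.
Hypothesis p1 : (1 <= p%:E)%E.

Lemma Lnorm_ae_le (f g : T -> R) : measurable_fun setT f -> measurable_fun setT g ->
  {ae mu, forall x, `|f x| <= `|g x|} ->
  ('N[mu]_p%:E[EFin \o f] <= 'N[mu]_p%:E[EFin \o g])%E.
Proof.
have p0 : 0 < p by apply: lt_le_trans ltr01 _; rewrite -lee_fin.
move=> mf mg fg; rewrite unlock /Lnorm.
have mp (h : T -> R) : measurable_fun setT h ->
    measurable_fun setT (fun x : T => (`|(h x)%:E| `^ p)%E).
  move=> mh; apply: (measurableT_comp (measurable_poweR p)).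
  by apply: measurableT_comp => //; exact/measurable_EFinP.
have I0 (h : T -> R) : (0 <= \int[mu]_x `|(h x)%:E| `^ p)%E.
  by apply: integral_ge0 => x _; exact: poweR_ge0.
apply: gt0_ler_poweR; rewrite ?in_itv/= ?leey ?I0// ?invr_ge0 ?(ltW p0)//.
apply: ae_ge0_le_integral => //; try exact: mp.
by apply: filterS fg => x fgx _; rewrite lee_fin ge0_ler_powR ?nnegrE// ltW.
Qed.

Lemma Lp_dist_le (M : R) (f g h : LfunType mu p1) : 0 <= M ->
  {ae mu, forall x, `|f x - g x| <= M * `|h x|} ->
  `|Lp_class f - Lp_class g| <= M * `|Lp_class h|.
Proof.
move=> M0 fg; rewrite -[X in X * _]ger0_norm// -normrZ -Lp_classB -Lp_classZ.
rewrite !Lp_normE -lee_fin !finite_norm_fine; apply: Lnorm_ae_le => //.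
by apply: filterS fg => x; rewrite normrM ger0_norm.
Qed.

(** For a measurable, essentially bounded [r] the product stays in L^p, so the
    default value in [Lp_mul] is not reached. *)
Lemma Lp_mulE (r : T -> R) (M : R) (u : Lp mu p1) : measurable_fun setT r ->
  {ae mu, forall x, `|r x| <= M} ->
  exists2 f : LfunType mu p1,
    f =1 (fun x => r x * Lp_repr u x) & Lp_mul r u = Lp_class f.
Proof.
move=> mr rM; set F := fun x => r x * Lp_repr u x.
exists (insubd (0 : LfunType mu p1) F) => //.
suff FL : F \in Lfun mu p%:E by move=> x; rewrite -[LHS]/(\val _ x) insubdK.
have mF : measurable_fun setT F by exact: measurable_funM.
apply/andP; split; rewrite !inE//= /finite_norm.
apply: (@le_lt_trans _ _ ('N[mu]_p%:E[EFin \o (M *: Lp_repr u : LfunType mu p1)])%E).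
  apply: Lnorm_ae_le => //; apply: filterS rM => x rx.
  rewrite [leRHS]normrM normrM ler_wpM2r// (le_trans rx)// ler_norm.
  by [].
exact: Lfunction_finite.
Qed.

Lemma Lp_mul_lipschitz (r : T -> R) (M : R) (u v : Lp mu p1) :
  measurable_fun setT r -> ('N[mu]_+oo[EFin \o r] <= M%:E)%E ->
  `|Lp_mul r u - Lp_mul r v| <= M * `|u - v|.
Proof.
move=> mr rM; have M0 : 0 <= M by rewrite -lee_fin (le_trans (Lnorm_ge0 _ _ _) rM).
have aM := Linfty_ae rM.
have [f fE ->] := Lp_mulE u mr aM; have [g gE ->] := Lp_mulE v mr aM.
rewrite -[in leRHS](Lp_reprK u) -[in leRHS](Lp_reprK v) -[in leRHS]Lp_classB.
apply: Lp_dist_le => //; apply: filterS aM => x rx.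
by rewrite fE gE -mulrBr normrM ler_wpM2r.
Qed.

Lemma Lp_mul_dist (r r' : T -> R) (M M' q : R) (u : Lp mu p1) :
  measurable_fun setT r -> measurable_fun setT r' ->
  ('N[mu]_+oo[EFin \o r] <= M%:E)%E -> ('N[mu]_+oo[EFin \o r'] <= M'%:E)%E ->
  ('N[mu]_+oo[EFin \o (fun x => r x - r' x)%R] <= q%:E)%E ->
  `|Lp_mul r u - Lp_mul r' u| <= q * `|u|.
Proof.
move=> mr mr' rM rM' rr'.
have q0 : 0 <= q by rewrite -lee_fin (le_trans (Lnorm_ge0 _ _ _) rr').
have [f fE ->] := Lp_mulE u mr (Linfty_ae rM).
have [g gE ->] := Lp_mulE u mr' (Linfty_ae rM').
rewrite -[in leRHS](Lp_reprK u); apply: Lp_dist_le => //.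
apply: filterS (Linfty_ae rr') => x rx.
by rewrite fE gE -mulrBl normrM ler_wpM2r.
Qed.
End potential.

(** * Norms of expansions and of paths *)

Section chaos_norm.
Context {R : realType} {Y : Type}.

Lemma chaos_norm_le (nm : Y -> \bar R) (p k : R) (F F' : chaos_index -> Y) :
  0 <= k -> (forall g, 0 <= nm (F g))%E -> (forall g, 0 <= nm (F' g))%E ->
  (forall g, nm (F g) <= k%:E * nm (F' g))%E ->
  (chaos_norm nm p F <= k%:E * chaos_norm nm p F')%E.
Proof.
move=> k0 F0 F'0 FF'; rewrite /chaos_norm.
set S' := (\esum_(g in [set: chaos_index])
    (nm (F' g) ^+ 2 * (chaos_weight g `^ (- p))%:E))%E.
have w0 (g : chaos_index) : (0 <= (chaos_weight g `^ (- p) : R)%:E)%E.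
  by rewrite lee_fin powR_ge0.
have S'0 : (0 <= S')%E by apply: esum_ge0 => g _; rewrite mule_ge0 ?expe_ge0.
have -> : (k%:E * S' `^ 2^-1 = ((k ^+ 2)%:E * S') `^ 2^-1)%E.
  rewrite poweRM ?lee_fin ?sqr_ge0// poweR_EFin powR12_sqrt ?sqr_ge0//.
  by rewrite sqrtr_sqr ger0_norm.
set S := (\esum_(g in _) _)%E.
have S0 : (0 <= S)%E by apply: esum_ge0 => g _; rewrite mule_ge0 ?expe_ge0.
apply: gt0_ler_poweR; rewrite ?in_itv/= ?leey ?andbT//.
- by rewrite mule_ge0// lee_fin sqr_ge0.
apply: ge_ereal_sup => _ [A fA <-].
apply: (@le_trans _ _ (\sum_(g \in A) ((k ^+ 2)%:E *
    (nm (F' g) ^+ 2 * (chaos_weight g `^ (- p))%:E)))%E).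
  apply: lee_fsum; first by case: fA.
  move=> g _; rewrite muleA; apply: lee_wpmul2r => //.
  rewrite EFin_expe !expe2 muleACA.
  exact: lee_pmul.
rewrite -ge0_mule_fsumr; last by move=> g; rewrite mule_ge0 ?expe_ge0.
apply: lee_wpmul2l; first by rewrite lee_fin sqr_ge0.
by apply: ereal_sup_ubound; exists A.
Qed.
End chaos_norm.

Section path_norm.
Context {R : realType} {V : normedModType R}.

Lemma path_norm_ge0 (T : R) (u : R -> V) : 0 <= T -> (0 <= path_norm T u)%E.
Proof.
move=> T0; apply: (@le_trans _ _ (`|u 0|%:E)); first by rewrite lee_fin.
by apply: ereal_sup_ubound; exists 0 => //=; rewrite in_itv/= lexx.
Qed.

(** This reduces to real bounds [b] on [v]; when [v] is unbounded the right-hand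
    side is infinite, as [k > 0]. *)
Lemma path_norm_le (T k : R) (u v : R -> V) : 0 <= T -> 0 < k ->
  (forall b, (forall t, 0 <= t -> t <= T -> `|v t| <= b) ->
     forall t, 0 <= t -> t <= T -> `|u t| <= k * b) ->
  (path_norm T u <= k%:E * path_norm T v)%E.
Proof.
move=> T0 k0 H; case E : (path_norm T v) => [b| |].
- apply: ge_ereal_sup => _ [t + <-]; rewrite /= in_itv/= => /andP[t0 tT].
  rewrite -EFinM lee_fin; apply: H => // r r0 rT.
  rewrite -lee_fin -E; apply: ereal_sup_ubound; exists r => //=.
  by rewrite in_itv/= r0.
- by rewrite gt0_muley ?lte_fin// leey.
- by have := path_norm_ge0 v T0; rewrite E.
Qed.
End path_norm.

(** For small [e] the exponential of [a N ln (1 / e)] is [(1 / e)^(a N)]. Away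
    from 0, moderateness bounds [b] by a constant. *)
Lemma log_growth_exp (R : realType) (a : R) (b : R -> R) (C N : R) (n : nat) :
  0 <= a -> 0 <= C -> 0 <= N ->
  (forall e, 0 < e <= 1 -> b e <= C * e ^- n) ->
  (\forall e \near 0^'+, b e <= N * ln e^-1) ->
  exists (k : nat) (K : R), 0 < K /\
    forall e, 0 < e <= 1 -> expR (a * b e) <= K * e ^- k.
Proof.
move=> a0 C0 N0 bC /nbhs_ballP[d /= d0 bln].
pose k := (Num.trunc (a * N)).+1.
exists k, (1 + expR (a * (C * d ^- n))); split.
  by rewrite addr_gt0 ?expR_gt0.
move=> e /andP[e0 e1]; have ek : 1 <= e ^- k.
  by rewrite invf_ge1 ?exprn_gt0// exprn_ile1// ltW.
have [ed|de] := ltP e d.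
  apply: (@le_trans _ _ (e ^- k)); last first.
    by rewrite ler_peMl ?lerDl ?expR_ge0// (le_trans _ ek).
  have be : b e <= N * ln e^-1.
    by apply: (bln e) => //; rewrite -ball_normE /= sub0r normrN gtr0_norm.
  have l0 : 0 <= ln e^-1 by rewrite ln_ge0// invf_ge1.
  apply: (@le_trans _ _ (expR (k%:R * ln e^-1))).
    rewrite ler_expR (le_trans (ler_wpM2l a0 be))// mulrA ler_wpM2r//.
    by rewrite ltW// truncnS_gt.
  by rewrite expRM_natl lnK ?posrE ?invr_gt0// exprVn.
apply: (@le_trans _ _ (1 + expR (a * (C * d ^- n)))); last first.
  by rewrite ler_peMr// addr_ge0 ?expR_ge0.
rewrite (le_trans _ (_ : expR (a * (C * d ^- n)) <= _)) ?lerDr//.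
rewrite ler_expR ler_wpM2l// (le_trans (bC _ _)) ?e0//.
by rewrite ler_wpM2l// lef_pV2 ?posrE ?exprn_gt0// lerXn2r ?nnegrE// ltW.
Qed.

(** * Uniqueness of the very weak solution *)

Theorem theorem10 (R : realType) (d : nat) (T : R)
  (D : set (L2 R d)) (L : L2 R d -> L2 R d)
  (F : chaos_index -> R -> L2 R d) (G : chaos_index -> L2 R d)
  (q : schwartz_distribution R d) (qe qe' : R -> 'rV[R]_d -> R)
  (U U' : R -> chaos_index -> R -> L2 R d) (s : R) :
  0 < T ->
  linear_operator D L -> closed_operator D L -> dense D ->
  generates_C0_semigroup D L ->
  chaosX_space1 T F ->
  (forall gamma, [lipschitz F gamma t | t in `[0, T]]) ->
  chaosD_space1 D G ->
  regularizing_net q qe -> regularizing_net q qe' ->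
  (exists2 e, e \in `]0, 1] & qe e <> qe' e) ->
  log_type qe -> log_type qe' ->
  (forall n : nat, exists2 C : R, 0 < C &
     forall e, e \in `]0, 1] ->
       (Linf_norm (fun x => qe e x - qe' e x)%R <= (C * e ^+ n)%:E)%E) ->
  very_weak_solution T D L q qe F G U ->
  very_weak_solution T D L q qe' F G U' ->
  1 < s ->
  moderate (fun e => chaosX_norm T s (U e)) ->
  moderate (fun e => chaosX_norm T s (U' e)) ->
  forall n : nat, exists2 c : R, 0 < c &
    forall e, e \in `]0, 1] ->
      (chaosX_norm T s (fun gamma t => U e gamma t - U' e gamma t)%R
         <= (c * e ^+ n)%:E)%E.
Proof.
move=> T0 linL _ _ gen _ _ _ _ _ _ [N N0 lq] _ close.
move=> [[sm _ _] [k1 [C1 [C10 mq]]] sol _] [[sm' _ _] [k1' [C1' [C10' mq']]] sol' _].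
move=> _ _ [k2 [C2 [C20 mU]]] n.
have [M [w [M0 w0 est]]] := @strong_solution_stability R
  (L2_completeNormedModType R d) D L linL gen.
pose Q e := fine (Linf_norm (qe e)).
have QE e : e \in `]0, 1] -> Linf_norm (qe e) = (Q e)%:E.
  move=> eI; rewrite /Q fineK// ge0_fin_numE ?Lnorm_ge0//.
  by rewrite (le_lt_trans (mq e eI))// ltry.
have Q0 e : 0 <= Q e by rewrite fine_ge0// Lnorm_ge0.
have [k3 [K [K0 expQ]]] : exists (k : nat) (K : R), 0 < K /\
    forall e, 0 < e <= 1 -> expR (M * T * Q e) <= K * e ^- k.
  apply: (@log_growth_exp _ _ _ C1 N k1); rewrite ?mulr_ge0 ?ltW//.
    move=> e e01; have eI : e \in `]0, 1] by rewrite in_itv.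
    by rewrite -lee_fin -QE// mq.
  have e1 : \forall e \near 0^'+, (e : R) <= 1 by exact: nbhs_right_le.
  have e0 : \forall e \near 0^'+, (0 : R) < e by exact: nbhs_right_gt.
  near=> e; rewrite -lee_fin -QE; first by near: e.
  by rewrite in_itv/=; apply/andP; split; near: e.
(* The extra powers [k2] and [k3] pay for the norm of [U' e] and for the exponential. *)
have [C3 C30 closem] := close (n + k2 + k3)%N.
exists (expR (w * T) * K * (M * T) * C3 * C2).
  by rewrite !mulr_gt0 ?expR_gt0.
move=> e eI; have /andP[e0 e1] : 0 < e <= 1 by move: eI; rewrite in_itv.
pose qq := C3 * e ^+ (n + k2 + k3).
have qq0 : 0 < qq by rewrite mulr_gt0// exprn_gt0.
pose kap := expR ((w + M * Q e) * T) * (M * T) * qq.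
have kap0 : 0 < kap by rewrite /kap !mulr_gt0 ?exprn_gt0 ?expR_gt0.
have mr : measurable_fun setT (qe e).
  by apply: continuous_measurable_row; exact: (sm e eI [::]).1.
have mr' : measurable_fun setT (qe' e).
  by apply: continuous_measurable_row; exact: (sm' e eI [::]).1.
have step : (chaosX_norm T s (fun gamma t => U e gamma t - U' e gamma t)%R <=
    kap%:E * chaosX_norm T s (U' e))%E.
  apply: chaos_norm_le => [|g|g|g]; rewrite ?path_norm_ge0 ?(ltW kap0) ?(ltW T0)//.
  apply: path_norm_le => [||b ub]; rewrite ?(ltW T0)//.
  apply: (est T (Q e) qq b (Lp_mul (qe e)) (Lp_mul (qe' e)) (F g) (G g)) => //.
  - exact: ltW.
  - by move=> x y; apply: Lp_mul_lipschitz => //; rewrite -QE.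
  - move=> x; apply: (Lp_mul_dist (M := Q e) (M' := C1' * e ^- k1')) => //.
    + by rewrite -QE.
    + exact: mq'.
    + exact: closem.
  - exact: (sol e eI).2.
  - exact: (sol' e eI).2.
apply: le_trans step _.
apply: (@le_trans _ _ (kap%:E * (C2 * e ^- k2)%:E)%E).
  by apply: lee_wpmul2l; [rewrite lee_fin ltW|exact: mU].
rewrite -EFinM lee_fin.
have kapK : kap <= expR (w * T) * (K * e ^- k3) * (M * T) * qq.
  rewrite /kap !ler_pM2r//; last by rewrite mulr_gt0.
  rewrite mulrDl expRD ler_pM2l ?expR_gt0//.
  by rewrite -mulrA [Q e * T]mulrC mulrA expQ ?e0.
apply: (le_trans (ler_wpM2r _ kapK)).
  by rewrite mulr_ge0 ?invr_ge0 ?exprn_ge0 ?ltW.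
rewrite /qq !exprD.
have f3 : e ^- k3 * e ^+ k3 = 1 by rewrite mulVf// expf_neq0// gt_eqF.
have f2 : e ^- k2 * e ^+ k2 = 1 by rewrite mulVf// expf_neq0// gt_eqF.
have -> : expR (w * T) * (K * e ^- k3) * (M * T) * (C3 * (e ^+ n * e ^+ k2 * e ^+ k3)) *
   (C2 * e ^- k2) = expR (w * T) * K * (M * T) * C3 * C2 * e ^+ n *
   ((e ^- k3 * e ^+ k3) * (e ^- k2 * e ^+ k2)) by ring.
by rewrite f3 f2 !mulr1.
Unshelve. all: by end_near. Qed.
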